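(* Let $Z=Z(\boldsymbol\sigma,X,Y)$ be a bi-parameter Haar system Hardy space, let $\mathcal V_Z$ denote $\mathcal V(\delta^2)$ equipped with the norm of $Z$, let $\mathcal U$ be a non-principal ultrafilter on $\mathbb N$, and let $D:\mathcal V_Z\to\mathcal V_Z$ be a Haar multiplier with $\|D\|_{\mathrm T^2\mathrm S}<\infty$. If $$\|D\|_{\mathrm T^2\mathrm S}<|\lambda_{\mathcal U}(D)-\mu_{\mathcal U}(D)|/8,$$ then $$\|\mathcal C\|_{\mathcal L(Z)}\le\frac{\|D\|+\|D\|_\infty+8\|D\|_{\mathrm T^2\mathrm S}}{|\lambda_{\mathcal U}(D)-\mu_{\mathcal U}(D)|-8\|D\|_{\mathrm T^2\mathrm S}},$$ and thus $\mathcal C:Z\to Z$ is bounded if $\|D:Z\to Z\|<\infty$. In particular, $\mathcal C$ is bounded on $Z$ if and only if there exists a bounded Haar multiplier $D:Z\to Z$ such that $\lambda_{\mathcal U}(D)\ne\mu_{\mathcal U}(D)$.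
   Context: Haar functions. $\mathcal D$ is the set of dyadic intervals in $[0,1)$, $\mathcal D_j=\{I\in\mathcal D:|I|=2^{-j}\}$, $j\ge0$. For $I\in\mathcal D$, $I^{+}=I^{+1}$ and $I^-=I^{-1}$ are its left and right halves, $h_I=\chi_{I^+}-\chi_{I^-}$; $(k_J)$ is a copy of $(h_I)$. $\mathcal V_1(\delta)=\mathrm{span}\{\chi_I:I\in\mathcal D\}$; $(h_I\otimes k_J)(s,t)=h_I(s)k_J(t)$; $\mathcal V(\delta^2)=\mathrm{span}\{h_I\otimes k_J\}$. A Haar multiplier is a linear operator $D$ with $D(h_I\otimes k_J)=d_{I,J}h_I\otimes k_J$, $d_{I,J}\in\mathbb R$, for all $I,J$; $\|D\|_\infty=\sup_{I,J}|d_{I,J}|$. The Capon projection $\mathcal C$ is the Haar multiplier on $\mathcal V(\delta^2)$ with coefficient $1$ if $|I|\le|J|$ and $0$ if $|I|>|J|$. Haar system Hardy spaces. A Haar system space is the completion of $\mathcal V_1(\delta)$ under a norm $\|\cdot\|$ such that $\|f\|=\|g\|$ whenever $|f|,|g|$ have the same distribution, and $\|\chi_{[0,1)}\|=1$; $\mathcal H(\delta)$ is the class of these. Let $\boldsymbol\sigma$ be one of the four product sets $S_1\times S_2$ with $S_1,S_2\in\{\{1\}^{\mathcal D},\{\pm1\}^{\mathcal D}\}$, and let $\mathbb E$ be the expectation with respect to the Haar (uniform product) probability measure over $((\sigma^{(1)}_I),(\sigma^{(2)}_J))\in\boldsymbol\sigma$. For $X,Y\in\mathcal H(\delta)$, $Z(\boldsymbol\sigma,X,Y)$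 is the completion of $\mathcal V(\delta^2)$ under, for $f=\sum a_{I,J}h_I\otimes k_J$, $$\|f\|_Z=\Big\|s\mapsto\Big\|t\mapsto\mathbb E\Big|\sum_{I,J}\sigma^{(1)}_I\sigma^{(2)}_Ja_{I,J}h_I(s)k_J(t)\Big|\Big\|_Y\Big\|_X.$$ $\|D\|=\|D:Z\to Z\|$ and $\|\mathcal C\|_{\mathcal L(Z)}$ are the operator norms with respect to $\|\cdot\|_Z$, with values in $[0,\infty]$. Functionals. For a Haar multiplier with bounded coefficients and a non-principal ultrafilter $\mathcal U$ on $\mathbb N$, $$\lambda_{\mathcal U}(D)=\lim_{j\to\mathcal U}\lim_{i\to\mathcal U}\sum_{I\in\mathcal D_i,J\in\mathcal D_j}|I||J|d_{I,J},\qquad \mu_{\mathcal U}(D)=\lim_{i\to\mathcal U}\lim_{j\to\mathcal U}\sum_{I\in\mathcal D_i,J\in\mathcal D_j}|I||J|d_{I,J}.$$ (If $\|D\|_{\mathrm T^2\mathrm S}<\infty$ the coefficients are bounded.) Bi-tree variation semi-norm. With $\omega,\xi$ ranging over $\{\pm1\}$, $$\|D\|_{\mathrm T^2\mathrm S}=\sum_{k=0}^\infty(k+1)\max_{I,J\in\mathcal D_k,\,\omega,\xi}|d_{I,J}-d_{I^\omega,J^\xi}|+\sum_{k=0}^\infty(k+1)\max_{I\in\mathcal D_k,\,J\in\mathcal D_{k+1},\,\omega,\xi}|d_{I,J}-d_{I^\omega,J^\xi}|$$ $$\qquad+\sum_{i=0}^\infty\sum_{j=0}^i\max_{I\in\mathcal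 D_i,\,J\in\mathcal D_j,\,\omega}|d_{I,J}-d_{I^\omega,J}|+\sum_{j=0}^\infty\sum_{i=0}^j\max_{I\in\mathcal D_i,\,J\in\mathcal D_{j+1},\,\xi}|d_{I,J}-d_{I,J^\xi}|.$$ *)

(* Defs.v *)
From HB Require Import structures.
From mathcomp Require Import all_boot all_order all_algebra.
From mathcomp Require Import all_classical all_reals all_analysis.

Set Implicit Arguments.
Unset Strict Implicit.
Unset Printing Implicit Defensive.

Import Order.TTheory GRing.Theory Num.Theory.
Import numFieldNormedType.Exports.

Local Open Scope classical_set_scope.
Local Open Scope ring_scope.

(* The pair (n, k) with k < 2 ^ n encodes the interval [k / 2^n, (k+1) / 2^n). *)
Definition dyadic : Type := {n : nat & 'I_(2 ^ n)}.

Definition dy (n : nat) (k : 'I_(2 ^ n)) : dyadic := Tagged (fun n => 'I_(2 ^ n)) k.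

Definition level (I : dyadic) : nat := tag I.

Lemma child_subproof (I : dyadic) (w : bool) :
  ((tagged I).*2 + w < 2 ^ (level I).+1)%N.
Proof.
case: I => n k /=; rewrite /level /= expnS mul2n.
apply: (@leq_trans (k.+1).*2); last by rewrite leq_double.
by case: w; rewrite doubleS /= ?addn1 ?addn0 ltnS.
Qed.

(* A sign in {+1, -1} is a boolean: false stands for +1 and true for -1, so
   that [child I false] is the left half I^+ and [child I true] is I^-. *)
Definition child (I : dyadic) (w : bool) : dyadic :=
  dy (Ordinal (child_subproof I w)).

Section FunctionSpaces.
Variable R : realType.

Definition dset (I : dyadic) : set R :=
  `[(tagged I)%:R / 2 ^+ level I, (tagged I).+1%:R / 2 ^+ level I[%classic.

Definition dlen (I : dyadic) : R := (2 ^+ level I)^-1.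

Definition lspan (V : lmodType R) (A : set V) : set V :=
  [set v | exists n (c : 'I_n -> R) (e : 'I_n -> V),
     (forall i, A (e i)) /\ v = \sum_(i < n) c i *: e i].

Lemma lspan_submod_closed (V : lmodType R) (A : set V) :
  submod_closed (fun v => v \in lspan A).
Proof.
split.
  rewrite unfold_in /=; apply/asboolP; exists 0%N, (fun=> 0), (fun=> 0).
  by rewrite big_ord0; split => // -[].
move=> a u v; rewrite !inE => -[m [c [e [Ae ->]]]] [n [c' [e' [Ae' ->]]]].
exists (m + n)%N.
exists (fun i => match fintype.split i with inl j => a * c j | inr j => c' j end).
exists (fun i => match fintype.split i with inl j => e j | inr j => e' j end).
split; first by move=> i; case: fintype.split.
rewrite big_split_ord /= scaler_sumr; congr (_ + _); apply: eq_bigr => i _.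
  by case: (fintype.split _) (unsplitK (@inl _ 'I_n i)) => j // [->]; rewrite scalerA.
by case: (fintype.split _) (unsplitK (@inr 'I_m _ i)) => j // [->].
Qed.

Definition V1 : set (R -> R) := lspan (range (fun I => \1_(dset I) : R -> R)).

Definition haar (I : dyadic) : R -> R :=
  \1_(dset (child I false)) \- \1_(dset (child I true)).

Definition haar2 (p : dyadic * dyadic) : R * R -> R :=
  fun x => haar p.1 x.1 * haar p.2 x.2.

Definition V2_pred : {pred R * R -> R} := fun f => f \in lspan (range haar2).

HB.instance Definition _ :=
  GRing.isSubmodClosed.Build R (R * R -> R) V2_pred
    (lspan_submod_closed (range haar2)).

(* V(delta^2), the functions (s, t) |-> f (s, t) spanned by the h_I \otimes k_J. *)
Record V2 := MkV2 { V2_val :> R * R -> R; V2_valP : V2_val \in V2_pred }.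

HB.instance Definition _ := [isSub for V2_val].
HB.instance Definition _ := [Choice of V2 by <:].
HB.instance Definition _ := [SubChoice_isSubLmodule of V2 by <:].


Lemma haar2_V2 (p : dyadic * dyadic) : haar2 p \in V2_pred.
Proof.
rewrite unfold_in /=; apply/asboolP; exists 1%N, (fun=> 1), (fun=> haar2 p).
by split; [move=> _; exists p | rewrite big_ord1 scale1r].
Qed.

Definition hk (p : dyadic * dyadic) : V2 := MkV2 (haar2_V2 p).

(* The coefficients a_{I,J} of f = \sum a_{I,J} h_I \otimes k_J; the expansion
   is unique because the functions h_I \otimes k_J are linearly independent. *)
Definition haar_expansion (f : V2) (a : dyadic * dyadic -> R) : Prop :=
  finite_set [set p | a p != 0] /\
  f = \sum_(p \in [set: dyadic * dyadic]) a p *: hk p.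

Definition haar_coef (f : V2) : dyadic * dyadic -> R :=
  xget (fun=> 0) [set a | haar_expansion f a].

Definition same_distribution (f g : R -> R) : Prop :=
  forall B : set R, measurable B ->
    lebesgue_measure (`[0, 1[ `&` f @^-1` B) =
    lebesgue_measure (`[0, 1[ `&` g @^-1` B).

(* A Haar system space is the completion of V_1(delta) under such a norm; only
   the values of the norm on V_1(delta) are meaningful. *)
Record haar_system_norm := HaarSystemNorm {
  hs_norm :> (R -> R) -> R;
  hs_normD : forall f g, V1 f -> V1 g -> hs_norm (f + g) <= hs_norm f + hs_norm g;
  hs_normZ : forall (a : R) f, V1 f -> hs_norm (a *: f) = `|a| * hs_norm f;
  hs_norm0_eq0 : forall f, V1 f -> hs_norm f = 0 -> f = 0;
  hs_norm_distr : forall f g, V1 f -> V1 g ->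
    same_distribution (fun x => `|f x|) (fun x => `|g x|) ->
    hs_norm f = hs_norm g;
  hs_norm1 : hs_norm \1_(`[0, 1[%classic) = 1 }.

Definition cylinders : set (set (dyadic -> bool)) :=
  [set A | exists I b, A = [set s | s I = b]].

Definition signs := g_sigma_algebraType cylinders.

Definition sgn (b : bool) : R := (-1) ^+ b.

(* The law of one coordinate: uniform on {+1, -1} if [r], else Dirac at +1. *)
Definition sign_law (r b : bool) : R := if r then 2^-1 else (~~ b)%:R.

(* P is the uniform product measure over S_1 x S_2, where S_i = {+1,-1}^D if
   [r_i] and S_i = {1}^D otherwise, seen as a measure on ({+1,-1}^D)^2. *)
Definition haar_sign_measure (r1 r2 : bool)
    (P : probability (signs * signs)%type R) : Prop :=
  forall (F G : seq dyadic) (b c : dyadic -> bool), uniq F -> uniq G ->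
    P [set s | (forall I, I \in F -> s.1 I = b I) /\
               (forall J, J \in G -> s.2 J = c J)] =
    ((\prod_(I <- F) sign_law r1 (b I)) * (\prod_(J <- G) sign_law r2 (c J)))%:E.

Definition Znorm (P : probability (signs * signs)%type R)
    (X Y : haar_system_norm) (f : V2) : R :=
  X (fun x => Y (fun y => fine ('E_P[fun s =>
    `|\sum_(p \in [set: dyadic * dyadic])
        sgn (s.1 p.1) * sgn (s.2 p.2) * haar_coef f p * haar p.1 x * haar p.2 y|]))).

Definition opnorm (V W : lmodType R) (N : V -> R) (M : W -> R) (T : V -> W) : \bar R :=
  ereal_sup [set (M (T f))%:E | f in [set f | N f <= 1]].

(* [T] acts diagonally on a copy [e] of the bi-parameter Haar system. *)
Definition haar_multiplier (V : lmodType R) (e : dyadic * dyadic -> V)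
    (T : V -> V) (d : dyadic -> dyadic -> R) : Prop :=
  forall I J, T (e (I, J)) = d I J *: e (I, J).

(* The linear operator with h_I \otimes k_J |-> d_{I,J} h_I \otimes k_J. *)
Definition diag_op (d : dyadic -> dyadic -> R) (f : V2) : V2 :=
  \sum_(p \in [set: dyadic * dyadic]) (d p.1 p.2 * haar_coef f p) *: hk p.

Definition capon_coef (I J : dyadic) : R := if dlen I <= dlen J then 1 else 0.

Definition capon : V2 -> V2 := diag_op capon_coef.

(* (Z, e) is a completion of V(delta^2) under the norm N. *)
Definition is_completion (N : V2 -> R) (Z : completeNormedModType R)
    (e : V2 -> Z) : Prop :=
  (forall f, `|e f| = N f) /\ dense (range e).

Definition sup_norm (d : dyadic -> dyadic -> R) : \bar R :=
  ereal_sup [set `|d p.1 p.2|%:E | p in [set: dyadic * dyadic]].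

Definition avg (d : dyadic -> dyadic -> R) (i j : nat) : R :=
  \sum_(I < 2 ^ i) \sum_(J < 2 ^ j) dlen (dy I) * dlen (dy J) * d (dy I) (dy J).

Definition lambda_fun (U : set_system nat) (d : dyadic -> dyadic -> R) : R :=
  lim (lim (avg d i j @[i --> U]) @[j --> U]).

Definition mu_fun (U : set_system nat) (d : dyadic -> dyadic -> R) : R :=
  lim (lim (avg d i j @[j --> U]) @[i --> U]).

Definition nonprincipal (U : set_system nat) : Prop :=
  forall n, U <> principal_filter n.

(* Maxima of nonnegative quantities over D_i x D_j and over {+1, -1}; the
   neutral element 0 is then harmless. *)
Definition max_over (i j : nat) (F : dyadic -> dyadic -> R) : R :=
  \big[Num.max/0]_(I < 2 ^ i) \big[Num.max/0]_(J < 2 ^ j) F (dy I) (dy J).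

Definition max_sign (F : bool -> R) : R := \big[Num.max/0]_(w : bool) F w.

Definition T2S (d : dyadic -> dyadic -> R) : \bar R :=
  (\sum_(0 <= k <oo) (k.+1%:R * max_over k k (fun I J =>
      max_sign (fun w => max_sign (fun x =>
        `|d I J - d (child I w) (child J x)|))))%:E
 + \sum_(0 <= k <oo) (k.+1%:R * max_over k k.+1 (fun I J =>
      max_sign (fun w => max_sign (fun x =>
        `|d I J - d (child I w) (child J x)|))))%:E
 + \sum_(0 <= i <oo) (\sum_(0 <= j < i.+1) max_over i j (fun I J =>
      max_sign (fun w => `|d I J - d (child I w) J|)))%:E
 + \sum_(0 <= j <oo) (\sum_(0 <= i < j.+1) max_over i j.+1 (fun I J =>
      max_sign (fun x => `|d I J - d I (child J x)|)))%:E)%E.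

End FunctionSpaces.

Arguments hk {R}.
Arguments capon {R}.

(* Main.v *)
(* Averaging D over the dyadic translations of both variables, which act
   isometrically on Z, replaces d_{I,J} by its mean over D_i x D_j, where i and j
   are the levels of I and J. Moving level a of the first variable to level n_a
   and level b of the second one to level m_b is an isometry as well, so the
   multiplier with coefficients avg d n_a m_b has norm at most ||D||. If the
   levels are chosen along U in the order m_0, n_0, m_1, n_1, ..., these
   coefficients are close to lambda for a >= b, that is |I| <= |J|, and close to mu
   otherwise. Hence ||lambda C + mu (1 - C)|| <= ||D||, which gives
   |lambda - mu| ||C|| <= ||D|| + |mu| <= ||D|| + ||D||_oo. *)
Require Import Defs.
From HB Require Import structures.
From mathcomp Require Import all_boot all_order all_algebra.
From mathcomp Require Import all_classical all_reals all_analysis.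
From mathcomp Require Import measurable_realfun ring lra.

Set Implicit Arguments.
Unset Strict Implicit.
Unset Printing Implicit Defensive.

Import Order.TTheory GRing.Theory Num.Theory.
Import numFieldNormedType.Exports.

Local Open Scope classical_set_scope.
Local Open Scope ring_scope.

(** The norms X and Y are accessible only through the law of |f|. Points of [0, 1) are therefore
    handled as sequences of binary digits, and translations and changes of level become instances of
    one operation, [phi]: read the digits n 0, n 1, ... and complement those marked by tau. It
    preserves the uniform law when n is injective. The expectation over signs is compatible with it,
    since at a point it depends on the coefficients met along two branches of the dyadic tree and
    not on the intervals that carry them. Each f has finite support, so finitely many digits suffice
    and the measure theory reduces to counting words. Sums and triangle inequalities are taken in Z,
    where the norm of e f is [Znorm] of f. *)

(** * Dyadic intervals as nodes of the binary tree *)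

Definition idx (I : dyadic) : nat := tagged I.

Lemma dyadic_inj (I J : dyadic) : level I = level J -> idx I = idx J -> I = J.
Proof.
case: I J => [n k] [m l]; rewrite /level /idx /= => nm; case: m / nm l => l kl.
by congr existT; apply: val_inj.
Qed.

(** The node at depth n on the branch w. Infinite words let a single w address all levels at
    once. *)
Fixpoint cell (w : nat -> bool) (n : nat) : dyadic :=
  if n is m.+1 then child (cell w m) (w m) else @dy 0 (@Ordinal (2 ^ 0) 0 isT).

Lemma level_cell w n : level (cell w n) = n.
Proof. by elim: n => //= n {2}<-. Qed.

Lemma level_child I b : level (child I b) = (level I).+1.
Proof. by []. Qed.

Lemma idx_child I b : idx (child I b) = ((idx I).*2 + b)%N.
Proof. by []. Qed.

Lemma child_inj I J b c : child I b = child J c -> I = J /\ b = c.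
Proof.
move=> IJ.
have lIJ : level I = level J by case: (congr1 level IJ).
have /eqP := congr1 idx IJ; rewrite !idx_child => /eqP iIJ.
have ebc : b = c.
  by have := congr1 odd iIJ; rewrite !oddD !odd_double /= !oddb.
split=> //; apply: dyadic_inj => //.
by apply: double_inj; move: iIJ; rewrite ebc => /addIn.
Qed.

Lemma cellP w w' n : cell w n = cell w' n <-> (forall i, (i < n)%N -> w i = w' i).
Proof.
split; last first.
  elim: n => //= n IH ww'; rewrite IH ?ww' // => i /ltnW; exact: ww'.
elim: n => //= n IH /child_inj[/IH ww' wn] i.
by rewrite ltnS leq_eqVlt => /orP[/eqP ->|/ww'].
Qed.

(** * Binary digits of points and Haar functions *)

Section Digits.
Variable R : realType.
Implicit Types (x : R) (I J : dyadic).

Definition unit_itv : set R := `[0, 1[%classic.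

Definition digit x (i : nat) : bool := odd (Num.trunc (x * 2 ^+ i.+1)).

Lemma unit_itvE x : unit_itv x = (0 <= x < 1) :> Prop.
Proof. by rewrite /unit_itv /= in_itv. Qed.

Lemma dsetE I x : 0 <= x ->
  (dset I x : Prop) <-> Num.trunc (x * 2 ^+ level I) = idx I.
Proof.
move=> x0; have x2 : 0 <= x * 2 ^+ level I by rewrite mulr_ge0 // exprn_ge0.
rewrite /dset /= in_itv /= ler_pdivrMr ?exprn_gt0 // ltr_pdivlMr ?exprn_gt0 //.
by rewrite -truncn_eq //; split => /eqP.
Qed.

(** Doubling appends one binary digit to the integer part; this is the induction step for the digit
    branch of x. *)
Lemma trunc_double x : 0 <= x ->
  Num.trunc (x * 2) = ((Num.trunc x).*2 + odd (Num.trunc (x * 2)%R))%N.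
Proof.
move=> x0; set m := Num.trunc (x * 2).
suff -> : Num.trunc x = m./2 by rewrite addnC odd_double_half.
have := truncn_itv (mulr_ge0 x0 (ler0n _ 2)); rewrite -/m => /andP[m1 m2].
apply: truncn_def; apply/andP; split.
  rewrite -(ler_pM2r (ltr0n R 2)) (le_trans _ m1) // -natrM ler_nat muln2.
  by rewrite -[leqRHS](odd_double_half m) leq_addl.
rewrite -(ltr_pM2r (ltr0n R 2)) (lt_le_trans m2) // -natrM ler_nat muln2.
by rewrite doubleS -[in leqLHS](odd_double_half m); case: (odd m).
Qed.

Lemma dset_cell_digit x n : unit_itv x -> dset (cell (digit x) n) x.
Proof.
rewrite unit_itvE => /andP[x0 x1]; apply/dsetE => //; rewrite level_cell.
elim: n => [|n IH] /=.
  by rewrite expr0 mulr1; apply: truncn_def; rewrite x0.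
rewrite idx_child -IH /digit exprSr mulrA [LHS]trunc_double //.
by rewrite mulr_ge0 // exprn_ge0.
Qed.

Lemma dset_unit I x : dset I x -> unit_itv x.
Proof.
rewrite unit_itvE /dset /= in_itv /= => /andP[h1 h2].
apply/andP; split; first by apply: le_trans h1; rewrite divr_ge0 // exprn_ge0.
apply: lt_le_trans h2 _; rewrite ler_pdivrMr ?exprn_gt0 // mul1r -natrX ler_nat.
exact: ltn_ord.
Qed.

Lemma dset_cell I x : unit_itv x -> dset I x <-> I = cell (digit x) (level I).
Proof.
move=> x01; split=> [|->]; last exact: dset_cell_digit.
have x0 : 0 <= x by move: x01; rewrite unit_itvE => /andP[].
move=> /dsetE; move=> /(_ x0) Ix; apply: dyadic_inj; rewrite ?level_cell //.
rewrite -Ix; have /dsetE := dset_cell_digit (level I) x01.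
by rewrite level_cell => /(_ x0).
Qed.

Definition lpt I : R := (idx I)%:R / 2 ^+ level I.

Lemma dset_lpt I : dset I (lpt I).
Proof.
rewrite /dset /= in_itv /= lexx ltr_pM2r ?invr_gt0 ?exprn_gt0 //.
by rewrite ltr_nat ltnSn.
Qed.

(** The digits below [level I] spell the address of I in the tree. *)
Definition word I : nat -> bool := digit (lpt I).

Lemma cell_word I : cell (word I) (level I) = I.
Proof. by symmetry; apply/dset_cell; [exact: (dset_unit (dset_lpt I))|exact: dset_lpt]. Qed.

Lemma word_cell w n i : (i < n)%N -> word (cell w n) i = w i.
Proof.
have := cell_word (cell w n); rewrite level_cell => /cellP h /h //.
Qed.

(** On [0, 1), h_I is nonzero exactly when I lies on the digit branch of x, and its value is the
    sign of the next digit. So at each point only one interval per level counts. *)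
Lemma haarE I x : haar I x = (`[< unit_itv x >])%:R
  * ((I == cell (digit x) (level I))%:R * sgn R (digit x (level I))).
Proof.
rewrite /haar /= !indicE; case: asboolP => [x01|nx]; last first.
  by rewrite !memNset ?mul0r ?subr0 // => /dset_unit.
rewrite mul1r.
have H b : ((x \in dset (child I b)) = (I == cell (digit x) (level I)) &&
     (b == digit x (level I))).
  apply/idP/idP; rewrite inE.
    move=> /(dset_cell _ x01); rewrite level_child /=.
    by move=> /child_inj[<- <-]; rewrite !eqxx.
  case/andP=> /eqP hI /eqP ->; apply/dset_cell => //.
  by rewrite level_child /= -hI.
rewrite !H; case: (_ == _); rewrite /= ?mul0r ?subr0 // mul1r /sgn.
by case: (digit _ _); rewrite ?expr0 ?expr1 ?sub0r ?subr0.
Qed.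

Lemma dlen_measure I : lebesgue_measure (dset I : set R) = (dlen R I)%:E.
Proof.
rewrite /dset lebesgue_measure_itv /= lte_fin ltr_pM2r ?invr_gt0 ?exprn_gt0 //.
rewrite ltr_nat ltnSn -EFinD -mulrBl -natrB // subSn // subnn mul1r //.
Qed.

End Digits.

(** * Rearrangements of digits preserve the law of step functions *)

Section Rearrangement.
Variable R : realType.

Definition depends_below (T : Type) (N : nat) (G : (nat -> bool) -> T) :=
  forall w w', (forall i, (i < N)%N -> w i = w' i) -> G w = G w'.

Definition injective_below N (n : nat -> nat) :=
  forall i j, (i < N)%N -> (j < N)%N -> n i = n j -> i = j.

Definition ext M (v : {ffun 'I_M -> bool}) (i : nat) : bool :=
  if insub i is Some j then v j else false.

Lemma extE M (v : {ffun 'I_M -> bool}) (i : 'I_M) : ext v i = v i.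
Proof. by rewrite /ext valK. Qed.

Definition xorf M (v r : {ffun 'I_M -> bool}) := [ffun i => v i (+) r i].

Lemma xorfK M (r : {ffun 'I_M -> bool}) : involutive (fun v => xorf v r).
Proof. by move=> v; apply/ffunP => i; rewrite !ffunE -addbA addbb addbF. Qed.

Lemma xorfC M (v r : {ffun 'I_M -> bool}) : xorf v r = xorf r v.
Proof. by apply/ffunP => i; rewrite !ffunE addbC. Qed.

(** For n = id this is the dyadic translation by tau; for tau constantly false it moves level i to
    level n i. *)
Definition phi (n : nat -> nat) (tau : nat -> bool) (w : nat -> bool) (i : nat) :=
  w (n i) (+) tau i.

(** The integral over [0, 1) of a function of the first M binary digits; such a function does not
    see the padding by [ext]. *)
Definition expect M (G : (nat -> bool) -> R) : R :=
  (\sum_(v : {ffun 'I_M -> bool}) G (ext v)) / 2 ^+ M.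

(* A mask of the N output digits is induced by a mask of the M input digits, so
   the left-hand side may also be averaged over all masks of the output. *)
Lemma expect_phi M N (n : nat -> nat) tau (G : (nat -> bool) -> R) :
  (forall i, (i < N)%N -> (n i < M)%N) ->
  (injective_below N n) ->
  depends_below N G -> expect M (G \o phi n tau) = expect N G.
Proof.
move=> nM ninj dG.
pose Phi (v : {ffun 'I_M -> bool}) : {ffun 'I_N -> bool} :=
  [ffun i : 'I_N => phi n tau (ext v) i].
have GPhi v : G (phi n tau (ext v)) = G (ext (Phi v)).
  by apply: dG => i iN; rewrite (extE _ (Ordinal iN)) ffunE.
(* The bit r i is planted at position n i, unambiguously because n is injective; positions outside
   the range of n get false. *)
pose lft (r : {ffun 'I_N -> bool}) : {ffun 'I_M -> bool} :=
  [ffun l : 'I_M => [exists i : 'I_N, (n i == l) && r i]].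
have Philft r v : Phi (xorf v (lft r)) = xorf (Phi v) r.
  apply/ffunP => i; rewrite !ffunE /phi.
  rewrite !(extE _ (Ordinal (nM i (ltn_ord i)))) !ffunE.
  suff -> : [exists i0 : 'I_N, (n i0 == n i) && r i0] = r i by rewrite addbAC.
  apply/existsP/idP => [[j /andP[/eqP nij rj]]|ri]; last by exists i; rewrite eqxx.
  by rewrite -(_ : j = i) //; apply/val_inj/(ninj _ _ (ltn_ord j) (ltn_ord i)).
rewrite /expect.
have card2 K : \sum_(v : {ffun 'I_K -> bool}) (1 : R) = 2 ^+ K.
  by rewrite sumr_const card_ffun card_bool card_ord natrX.
have two0 K : (2 ^+ K : R) != 0 by rewrite expf_neq0 ?pnatr_eq0.
apply/eqP; rewrite eqr_div //; apply/eqP.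
rewrite -!card2 !mulr_sumr.
(* This double sum is evaluated twice: for fixed r the shift by [lft r] absorbs r, and for fixed v
   the shift by [Phi v] leaves a sum over all words. *)
transitivity (\sum_(r : {ffun 'I_N -> bool}) \sum_(v : {ffun 'I_M -> bool})
    G (ext (xorf (Phi v) r))).
  apply: eq_bigr => r _; rewrite mulr1 (reindex_inj (inv_inj (xorfK (lft r)))).
  by apply: eq_bigr => v _; rewrite /= GPhi Philft.
rewrite exchange_big; apply: eq_bigr => v _; rewrite mulr1.
rewrite [RHS](reindex_inj (inv_inj (xorfK (Phi v)))) /=.
by apply: eq_bigr => r _; rewrite xorfC.
Qed.

Lemma cell_ord_subproof w M : (idx (cell w M) < 2 ^ M)%N.
Proof. by rewrite -{2}(level_cell w M) ltn_ord. Qed.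

Definition cell_ord w M : 'I_(2 ^ M) := Ordinal (cell_ord_subproof w M).

Lemma dy_cell_ord w M : dy (cell_ord w M) = cell w M.
Proof. by apply: dyadic_inj; rewrite ?level_cell. Qed.

Lemma dy_inj M : injective (@dy M).
Proof. by move=> k l kl; apply: val_inj; exact: (congr1 idx kl). Qed.

Lemma sum_word M (G : (nat -> bool) -> R) : depends_below M G ->
  \sum_(k < 2 ^ M) G (word R (dy k)) = \sum_(v : {ffun 'I_M -> bool}) G (ext v).
Proof.
move=> dG.
have b : bijective (fun v : {ffun 'I_M -> bool} => cell_ord (ext v) M).
  apply: inj_card_bij => [v v' vv'|]; last by rewrite card_ffun card_bool !card_ord.
  have /cellP h : cell (ext v) M = cell (ext v') M by rewrite -!dy_cell_ord vv'.
  by apply/ffunP => i; have := h i (ltn_ord i); rewrite !extE.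
rewrite (reindex _ (onW_bij _ b)) /=; apply: eq_bigr => v _.
by apply: dG => i iM; rewrite dy_cell_ord word_cell.
Qed.

Definition step (Q : (nat -> bool) -> R) (x : R) : R :=
  if `[< unit_itv x >] then Q (digit x) else 0.

Lemma fsumT (I : finType) (A : nmodType) (F : I -> A) :
  \sum_(i \in [set: I]) F i = \sum_i F i.
Proof.
rewrite (@fsbigE _ _ _ _ _ (index_enum I)) ?index_enum_uniq //.
  by apply: eq_bigl => i; rewrite in_setT.
by move=> i _ ; rewrite mem_index_enum.
Qed.

Lemma V1_step M Q : depends_below M Q -> V1 (step Q).
Proof.
move=> dQ; exists (2 ^ M)%N, (fun k => Q (word R (dy k))),
  (fun k => \1_(dset (dy k))); split; first by move=> k; exists (dy k).
apply/funext => x; rewrite fct_sumE /step; case: asboolP => x01; last first.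
  rewrite big1 // => k _; rewrite fctE indicE memNset ?scaler0 //.
  by move=> /dset_unit.
rewrite (bigD1 (cell_ord (digit x) M)) //= big1 ?addr0 => [|k kn].
  rewrite fctE indicE mem_set; last by rewrite dy_cell_ord; exact: dset_cell_digit.
  by rewrite [_ *: _]mulr1; apply: dQ => i iM; rewrite dy_cell_ord word_cell.
rewrite fctE indicE memNset ?scaler0 // => /(dset_cell _ x01).
by rewrite -dy_cell_ord => /dy_inj kE; rewrite kE eqxx in kn.
Qed.

(** The preimage is a disjoint union of cells of level M, each of measure 2^-M. *)
Lemma step_law M Q (B : set R) : depends_below M Q ->
  lebesgue_measure (`[0, 1[ `&` (fun x => `|step Q x|) @^-1` B) =
  (expect M (fun w => (`[< B `|Q w| >])%:R))%:E.
Proof.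
move=> dQ.
pose F (k : 'I_(2 ^ M)) : set R :=
  if `[< B `|Q (word R (dy k))| >] then dset (dy k) else set0.
have -> : `[0, 1[ `&` (fun x => `|step Q x|) @^-1` B = \bigcup_(k in setT) F k.
  apply/seteqP; split=> x /=.
    move=> [x01]; rewrite /step asboolT // => BQ.
    exists (cell_ord (digit x) M) => //; rewrite /F dy_cell_ord.
    rewrite (dQ _ (digit x)) ?asboolT //; first exact: dset_cell_digit.
    by move=> i iM; rewrite word_cell.
  move=> [k _]; rewrite /F; case: asboolP => // BQ xk.
  have x01 := dset_unit xk; split=> //.
  rewrite /step asboolT // (dQ _ (word R (dy k))) // => i iM.
  by have /(dset_cell _ x01) -> := xk; rewrite word_cell.
rewrite measure_fin_bigcup //; last 3 first.
- exact: finite_finset.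
- apply/trivIsetP => k l _ _ kl; apply/seteqP; split=> // x [].
  rewrite /F; case: asboolP => // _; case: asboolP => // _ xk xl.
  have x01 := dset_unit xk; move: kl => /eqP; apply; apply: dy_inj.
  by move/(dset_cell _ x01): xk => ->; move/(dset_cell _ x01): xl => ->.
- by move=> k _; rewrite /F; case: ifP => // _; exact: measurable_itv.
rewrite fsumT /expect -(@sum_word M (fun w => (`[< B `|Q w| >])%:R)); last first.
  by move=> w w' ww'; rewrite (dQ _ w').
rewrite mulr_suml -sumEFin; apply: eq_bigr => k _; rewrite /F.
case: ifP => _; last by rewrite measure0 mul0r.
by rewrite mul1r; exact: dlen_measure.
Qed.

(** Distinct digits, complemented or not, are again independent and uniform, so both step functions
    have the same distribution. *)
Lemma hs_norm_step_phi (X : haar_system_norm R) N n tau Q :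
  (injective_below N n) ->
  depends_below N Q ->
  X (step (Q \o phi n tau)) = X (step Q).
Proof.
move=> ninj dQ.
pose M := (\max_(i < N) (n i)).+1.
have nM i : (i < N)%N -> (n i < M)%N.
  by move=> iN; rewrite ltnS (@leq_bigmax _ (fun i : 'I_N => n i) (Ordinal iN)).
have dQp : depends_below M (Q \o phi n tau).
  by move=> w w' ww'; apply: dQ => i iN; rewrite /phi ww' ?nM.
apply: hs_norm_distr; [exact: V1_step dQp|exact: V1_step dQ|] => B mB.
rewrite (step_law B dQp) (step_law B dQ).
congr EFin.
rewrite -[in RHS](@expect_phi M N n tau) // => w w' ww'.
by rewrite (dQ _ w').
Qed.

End Rearrangement.

(** * Expectation over the random signs *)

Section Signs.
Variables (R : realType) (r1 r2 : bool) (P : probability (signs * signs)%type R).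
Hypothesis hP : haar_sign_measure r1 r2 P.

Lemma measurable_sign (I : dyadic) (b : bool) :
  measurable ([set s | s I = b] : set signs).
Proof. by apply: sub_sigma_algebra; exists I, b. Qed.

Definition sign_pattern N N' (I : 'I_N -> dyadic) (J : 'I_N' -> dyadic)
    (b : {ffun 'I_N -> bool}) (c : {ffun 'I_N' -> bool}) :
    set (signs * signs)%type :=
  [set s | (forall i, s.1 (I i) = b i) /\ (forall j, s.2 (J j) = c j)].

Lemma measurable_pattern N N' (I : 'I_N -> dyadic) (J : 'I_N' -> dyadic) b c :
  measurable (sign_pattern I J b c).
Proof.
have -> : sign_pattern I J b c =
    (\bigcap_(i in [set: 'I_N]) (fst @^-1` [set s : signs | s (I i) = b i]))
    `&` (\bigcap_(j in [set: 'I_N']) (snd @^-1` [set s : signs | s (J j) = c j])).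
  apply/seteqP; split=> s /= [h1 h2].
    by split=> i _ /=.
  by split=> i; [exact: h1|exact: h2].
apply: measurableI; apply: fin_bigcap_measurable; try exact: finite_finset.
  by move=> i _; rewrite -[X in measurable X]setTI; apply: measurable_fst => //;
    exact: measurable_sign.
by move=> i _; rewrite -[X in measurable X]setTI; apply: measurable_snd => //;
  exact: measurable_sign.
Qed.

Definition pattern_weight r N (b : {ffun 'I_N -> bool}) : R :=
  \prod_i sign_law R r (b i).

Lemma pattern_prob N N' (I : 'I_N -> dyadic) (J : 'I_N' -> dyadic) b c :
  injective I -> injective J ->
  P (sign_pattern I J b c) = (pattern_weight r1 b * pattern_weight r2 c)%:E.
Proof.
move=> injI injJ.
(* The measure is specified through signs given on all dyadic intervals; [lft] extends a finite
   pattern, with the harmless value false off the family. *)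
pose lft K (L : 'I_K -> dyadic) (u : {ffun 'I_K -> bool}) (D : dyadic) :=
  if [pick i | L i == D] is Some i then u i else false.
have lftE K (L : 'I_K -> dyadic) u i : injective L -> lft K L u (L i) = u i.
  move=> Linj; rewrite /lft; case: pickP => [j /eqP/Linj -> //|/(_ i)].
  by rewrite eqxx.
have := @hP [seq I i | i <- enum 'I_N] [seq J i | i <- enum 'I_N']
  (lft _ I b) (lft _ J c).
have um K (L : 'I_K -> dyadic) : injective L -> uniq [seq L i | i <- enum 'I_K].
  by move=> /map_inj_uniq ->; exact: enum_uniq.
move=> /(_ (um _ _ injI) (um _ _ injJ)).
rewrite !big_map -!enumT /pattern_weight.
rewrite (eq_bigr (fun i => sign_law R r1 (b i))); last by move=> i _; rewrite lftE.
rewrite [in X in _ * X](eq_bigr (fun i => sign_law R r2 (c i))); last first.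
  by move=> i _; rewrite lftE.
rewrite !big_enum /= => <-; congr (P _); apply/seteqP; split=> s /= [h1 h2]; split.
- by move=> _ /mapP[i _ ->]; rewrite h1 lftE.
- by move=> _ /mapP[i _ ->]; rewrite h2 lftE.
- by move=> i; rewrite h1 ?lftE // map_f // mem_enum.
- by move=> i; rewrite h2 ?lftE // map_f // mem_enum.
Qed.

(** The integrand is a finite sum of multiples of indicators of sign patterns. The right-hand side
    no longer mentions I and J: the expectation is unchanged when other intervals carry the
    coefficients, and the isometries rest on this. *)
Lemma expectation_signs N N' (I : 'I_N -> dyadic) (J : 'I_N' -> dyadic)
    (H : {ffun 'I_N -> bool} -> {ffun 'I_N' -> bool} -> R) :
  injective I -> injective J -> (forall b c, 0 <= H b c) ->
  ('E_P[fun s => H [ffun i => s.1 (I i)] [ffun j => s.2 (J j)]])%E =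
  (\sum_b \sum_c pattern_weight r1 b * pattern_weight r2 c * H b c)%:E.
Proof.
move=> injI injJ H0; rewrite expectation.unlock.
have mp (p : {ffun 'I_N -> bool} * {ffun 'I_N' -> bool}) :
    measurable (sign_pattern I J p.1 p.2) by exact: measurable_pattern.
under eq_integral => s _.
  rewrite (_ : (H _ _)%:E = \sum_(p <- index_enum _)
     (H p.1 p.2)%:E * (\1_(sign_pattern I J p.1 p.2) s)%:E)%E; last first.
    rewrite (bigD1 ([ffun i => s.1 (I i)], [ffun j => s.2 (J j)])) //=.
    rewrite indicE mem_set; last by split=> i; rewrite ffunE.
    rewrite mule1 big1 ?adde0 // => -[b c] /= bc.
    rewrite indicE memNset ?mule0 // => -[h1 h2]; case/eqP: bc.
    by congr pair; apply/ffunP => i; rewrite ffunE.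
  over.
rewrite ge0_integral_sum //; last 2 first.
- by move=> p; apply/measurable_funeM/measurable_EFinP/measurable_indic; exact: measurable_pattern.
- by move=> p s _; rewrite mule_ge0 ?lee_fin.
under eq_bigr => p _.
  rewrite ge0_integralZl_EFin //; last first.
    by apply/measurable_EFinP/measurable_indic; exact: measurable_pattern.
  rewrite integral_indic // setIT [X in (_ * X)%E](pattern_prob p.1 p.2 injI injJ).
  over.
rewrite pair_big /= -sumEFin; apply: eq_bigr => p _ /=.
by rewrite -EFinM mulrC.
Qed.

End Signs.

(** * Finite Haar expansions and uniqueness of coefficients *)

Section Coefficients.
Variable R : realType.
Implicit Types (a b : dyadic * dyadic -> R) (f : V2 R).

Definition supp_below N a :=
  forall p, ~~ ((level p.1 < N) && (level p.2 < N))%N -> a p = 0.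

Definition dyads N : seq dyadic :=
  flatten [seq [seq dy k | k <- enum 'I_(2 ^ n)] | n <- iota 0 N].

Lemma mem_dyads N I : (I \in dyads N) = (level I < N)%N.
Proof.
apply/flattenP/idP => [[_ /mapP[n nN ->]] /mapP[k _ ->]|IN].
  by move: nN; rewrite mem_iota.
exists [seq dy k | k <- enum 'I_(2 ^ level I)].
  by apply/mapP; exists (level I) => //; rewrite mem_iota.
by apply/mapP; exists (tagged I); [rewrite mem_enum|case: I {IN}].
Qed.

Definition grid N := undup [seq (K, L) | K <- dyads N, L <- dyads N].

Lemma mem_grid N p : (p \in grid N) = (level p.1 < N)%N && (level p.2 < N)%N.
Proof.
rewrite mem_undup -!mem_dyads; apply/allpairsP/andP => [[q [h1 h2 ->]]//|[h1 h2]].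
by exists p; split => //; case: p {h1 h2}.
Qed.

Lemma fsum_seq (I : choiceType) (M : nmodType) (r : seq I) (F : I -> M) :
  uniq r -> (forall p, p \notin r -> F p = 0) ->
  \sum_(p \in [set: I]) F p = \sum_(p <- r) F p.
Proof.
move=> ur F0; rewrite (@fsbigE _ _ _ _ _ r) //; last by move=> i _; exact: F0.
by apply: eq_bigl => i; rewrite in_setT.
Qed.

Definition hsum a : V2 R := \sum_(p \in [set: dyadic * dyadic]) a p *: hk p.

Lemma hsumE N a : supp_below N a -> hsum a = \sum_(p <- grid N) a p *: hk p.
Proof.
move=> aN; apply: fsum_seq; first exact: undup_uniq.
by move=> p; rewrite mem_grid => /aN ->; rewrite scale0r.
Qed.

Lemma supp_belowS N M a : (N <= M)%N -> supp_below N a -> supp_below M a.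
Proof.
move=> NM aN p h; apply: aN; apply: contra h => /andP[h1 h2].
by rewrite !(leq_trans _ NM).
Qed.

Lemma hsumP N c a b : supp_below N a -> supp_below N b ->
  hsum (fun p => c * a p + b p) = c *: hsum a + hsum b.
Proof.
move=> aN bN; rewrite (hsumE aN) (hsumE bN) (@hsumE N) => [|p h]; last first.
  by rewrite aN // bN // mulr0 addr0.
rewrite scaler_sumr -big_split; apply: eq_bigr => p _ /=.
by rewrite scalerDl scalerA.
Qed.

Lemma hsum_apply N a x : supp_below N a ->
  V2_val (hsum a) x = \sum_(p \in [set: dyadic * dyadic]) a p * haar p.1 x.1 * haar p.2 x.2.
Proof.
move=> aN; rewrite (hsumE aN) (@fsum_seq _ _ (grid N)) ?undup_uniq //; last first.
  by move=> p; rewrite mem_grid => /aN ->; rewrite !mul0r.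
have -> : V2_val (\sum_(p <- grid N) a p *: hk p) =
    \sum_(p <- grid N) a p *: haar2 p.
  elim/big_ind2 : _ => // f g f' g' ff' gg'; rewrite -ff' -gg' //.
rewrite fct_sumE; apply: eq_bigr => p _.
by rewrite fctE /haar2 -mulrA.
Qed.

Lemma cell_level_inj w N (n : nat -> nat) :
  (injective_below N n) ->
  injective (fun i : 'I_N => cell w (n i)).
Proof.
move=> ninj i j /(congr1 level); rewrite !level_cell => nij.
exact/val_inj/(ninj _ _ (ltn_ord i) (ltn_ord j)).
Qed.

(** At a point only the nodes on two branches contribute; n and m list the levels that occur. *)
Lemma fsum_cells (M : nmodType) (F : dyadic * dyadic -> M) w w' N (n m : nat -> nat) :
  (injective_below N n) ->
  (injective_below N m) ->
  (forall p, F p != 0 -> exists i j,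
     [/\ (i < N)%N, (j < N)%N & p = (cell w (n i), cell w' (m j))]) ->
  \sum_(p \in [set: dyadic * dyadic]) F p =
  \sum_(i < N) \sum_(j < N) F (cell w (n i), cell w' (m j)).
Proof.
move=> ninj minj F0.
pose r := [seq (cell w (n i), cell w' (m j)) | i : 'I_N <- enum 'I_N, j : 'I_N <- enum 'I_N].
rewrite (@fsum_seq _ _ r).
- by rewrite big_allpairs_dep /= big_enum; apply: eq_bigr => i _; rewrite big_enum.
- apply: allpairs_uniq; rewrite ?enum_uniq // => -[i j] [k l] _ _ /= [].
  move=> h1 h2; congr pair; first exact: (@cell_level_inj w N n).
  exact: (@cell_level_inj w' N m).
- move=> p; apply: contraNeq => /F0[i [j [iN jN ->]]].
  by apply/allpairsP; exists (Ordinal iN, Ordinal jN); rewrite !mem_enum.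
Qed.

(** Changing the last digit of w keeps the lower terms and reverses the sign of the top one, so the
    top coefficient vanishes. *)
Lemma haar_uniq1 N (c : dyadic -> R) :
  (forall w, \sum_(i < N) c (cell w i) * sgn R (w i) = 0) ->
  forall I, (level I < N)%N -> c I = 0.
Proof.
elim: N => // N IH h.
have top w : c (cell w N) = 0.
  pose u (z : bool) i := if i == N then z else w i.
  have cu z i : (i <= N)%N -> cell (u z) i = cell w i.
    move=> iN; apply/cellP => k ki.
    by rewrite /u ltn_eqF // (leq_trans ki).
  have S z : \sum_(i < N) c (cell (u z) i) * sgn R (u z i) =
      \sum_(i < N) c (cell w i) * sgn R (w i).
    by apply: eq_bigr => i _; rewrite cu ?(ltnW (ltn_ord i)) // /u ltn_eqF.
  have := h (u true); have := h (u false).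
  rewrite !big_ord_recr /= !S !cu // /u eqxx /sgn expr0 expr1 => h1 h2; lra.
move=> I; rewrite ltnS leq_eqVlt => /orP[/eqP IN|IN].
  by rewrite -(cell_word R I) IN.
apply: IH => // w; have := h w.
by rewrite big_ord_recr /= top mul0r addr0.
Qed.

Lemma hsum_apply_cell N a x y : supp_below N a -> unit_itv x -> unit_itv y ->
  V2_val (hsum a) (x, y) = \sum_(i < N) \sum_(j < N)
    a (cell (digit x) i, cell (digit y) j) * (sgn R (digit x i) * sgn R (digit y j)).
Proof.
move=> aN x01 y01; rewrite (hsum_apply _ aN).
rewrite (@fsum_cells _ _ (digit x) (digit y) N id id) //.
  apply: eq_bigr => i _; apply: eq_bigr => j _ /=.
  by rewrite !haarE !asboolT // !level_cell !eqxx !mul1r mulrA.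
move=> p; rewrite -mulrA !mulf_eq0 !negb_or => /and3P[ap].
rewrite !haarE !asboolT // !mul1r => h1 h2.
exists (level p.1), (level p.2).
have /andP[l1 l2] : (level p.1 < N)%N && (level p.2 < N)%N.
  by apply: contraNT ap => /aN ->.
have e1 : p.1 = cell (digit x) (level p.1).
  by apply/eqP; apply: contraNT h1 => /negPf ->; rewrite mul0r.
have e2 : p.2 = cell (digit y) (level p.2).
  by apply/eqP; apply: contraNT h2 => /negPf ->; rewrite mul0r.
by split; rewrite // -e1 -e2 -surjective_pairing.
Qed.

(** Left endpoints of cells of level N realise all digit words of length N; the one-variable
    uniqueness is then applied in each variable. *)
Lemma hsum_inj0 N a : supp_below N a -> hsum a = 0 -> forall p, a p = 0.
Proof.
move=> aN a0 p.
have [/andP[p1 p2]|] := boolP ((level p.1 < N) && (level p.2 < N))%N; last exact: aN.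
have h w w' : \sum_(i < N) \sum_(j < N)
    a (cell w i, cell w' j) * (sgn R (w i) * sgn R (w' j)) = 0.
  pose x u : R := lpt R (cell u N).
  have x01 u : unit_itv (x u) by exact: (dset_unit (dset_lpt _ _)).
  have := hsum_apply_cell aN (x01 w) (x01 w').
  rewrite a0 [V2_val 0 _](_ : _ = 0) // => h; rewrite [RHS]h.
  have xd u i : (i < N)%N -> digit (x u) i = u i by exact: word_cell.
  apply: eq_bigr => i _; apply: eq_bigr => j _; rewrite !xd //.
  have xc u k : (k < N)%N -> cell (digit (x u)) k = cell u k.
    by move=> kN; apply/cellP => l lk; rewrite xd // (ltn_trans lk).
  by rewrite !xc.
rewrite (surjective_pairing p).
apply: (@haar_uniq1 N (fun J => a (p.1, J))) => // w'.
apply: (@haar_uniq1 N (fun I => \sum_(i < N) a (I, cell w' i) * sgn R (w' i))) => // w.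
rewrite -[RHS](h w w'); apply: eq_bigr => i _; rewrite mulr_suml.
by apply: eq_bigr => j _; rewrite -mulrA [sgn R (w' j) * _]mulrC.
Qed.

Lemma hsum_inj N a b : supp_below N a -> supp_below N b -> hsum a = hsum b -> a = b.
Proof.
move=> aN bN ab; apply/funext => p.
have abN : supp_below N (fun p => -1 * b p + a p).
  by move=> q h; rewrite aN // bN // mulr0 addr0.
have := hsum_inj0 abN; rewrite (hsumP _ bN aN) ab scaleN1r addNr => /(_ erefl p).
by rewrite mulN1r addrC => /subr0_eq.
Qed.

Lemma supp_below_finite N a : supp_below N a -> finite_set [set p | a p != 0].
Proof.
move=> aN; apply: (@sub_finite_set _ _ [set` grid N]); last exact: finite_seq.
by move=> p /= ap; rewrite mem_grid; apply: contraNT ap => /aN ->.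
Qed.

Lemma finite_supp_below a : finite_set [set p | a p != 0] -> exists N, supp_below N a.
Proof.
move=> /finite_seqP[s sE].
exists (\max_(p <- s) maxn (level p.1) (level p.2)).+1 => p; apply: contraNeq => ap.
have ps : p \in s by have : [set` s] p by rewrite -sE.
have := @leq_bigmax_seq _ s xpredT (fun p => maxn (level p.1) (level p.2)) p ps isT.
by rewrite geq_max !ltnS.
Qed.

(** [haar_coef] chooses some expansion; uniqueness identifies the choice. *)
Lemma haar_coef_hsum N a : supp_below N a -> haar_coef (hsum a) = a.
Proof.
move=> aN.
have : haar_expansion (hsum a) (haar_coef (hsum a)).
  by apply: (@xgetPex _ (fun=> 0)); exists a; split => //; exact: supp_below_finite aN.
move=> [/finite_supp_below[M cM]] /esym.
move/hsum_inj; apply; first exact: (supp_belowS (leq_maxr N M)).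
exact: (supp_belowS (leq_maxl N M)).
Qed.

Lemma V2_hsum f : exists N, supp_below N (haar_coef f) /\ f = hsum (haar_coef f).
Proof.
suff [N [a [aN ->]]] : exists N a, supp_below N a /\ f = hsum a.
  by exists N; rewrite (haar_coef_hsum aN).
case: f => f fP; have := fP; rewrite unfold_in => /asboolP.
move=> [n [c [e [he fE]]]].
have {}he i : exists p, haar2 p = e i by have [p _ <-] := he i; exists p.
have [q qE] := choice he.
pose N := (\max_(i < n) maxn (level (q i).1) (level (q i).2)).+1.
(* An element of the span may repeat Haar functions; their scalars are added up. *)
pose a p := \sum_(i < n) c i * (q i == p)%:R.
have qN i : q i \in grid N.
  have := @leq_bigmax _ (fun i : 'I_n => maxn (level (q i).1) (level (q i).2)) i.
  by rewrite geq_max mem_grid !ltnS.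
have aN : supp_below N a.
  move=> p; rewrite -mem_grid => pN; apply: big1 => i _.
  by rewrite (negPf (contraNneq _ pN)) ?mulr0 // => <-.
exists N, a; split=> //; apply: val_inj => /=; rewrite fE (hsumE aN).
transitivity (V2_val (\sum_(i < n) c i *: hk (q i))).
  have -> : V2_val (\sum_(i < n) c i *: hk (q i)) = \sum_(i < n) c i *: haar2 (q i).
    by elim/big_ind2 : _ => // f1 g f' g' ff' gg'; rewrite -ff' -gg' //.
  by apply: eq_bigr => i _; rewrite qE.
congr V2_val; rewrite /a.
under [RHS]eq_bigr do rewrite scaler_suml.
rewrite exchange_big /=; apply: eq_bigr => i _.
rewrite (bigD1_seq (q i)) ?undup_uniq //= eqxx mulr1 big1 ?addr0 // => p pq.
by rewrite eq_sym (negPf pq) mulr0 scale0r.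
Qed.

Lemma haar_coefP c f g p : haar_coef (c *: f + g) p = c * haar_coef f p + haar_coef g p.
Proof.
have [N [fN fE]] := V2_hsum f; have [M [gM gE]] := V2_hsum g.
have {}fN := supp_belowS (leq_maxl N M) fN; have {}gM := supp_belowS (leq_maxr N M) gM.
rewrite {1}fE {1}gE -(hsumP _ fN gM) (@haar_coef_hsum (maxn N M)) // => q h.
by rewrite fN // gM // mulr0 addr0.
Qed.

End Coefficients.

(** * The norm in terms of digits, and its invariance *)

Section Isometry.
Variables (R : realType) (r1 r2 : bool) (P : probability (signs * signs)%type R).
Hypothesis hP : haar_sign_measure r1 r2 P.
Variables X Y : haar_system_norm R.
Implicit Types (a b : dyadic * dyadic -> R).

Definition sign_mean N (A : nat -> nat -> R) : R :=
  \sum_(b : {ffun 'I_N -> bool}) \sum_(c : {ffun 'I_N -> bool})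
    pattern_weight R r1 b * pattern_weight R r2 c *
    `|\sum_(i < N) \sum_(j < N) sgn R (b i) * sgn R (c j) * A i j|.

Lemma eq_sign_mean N A B :
  (forall i j, (i < N)%N -> (j < N)%N -> A i j = B i j) ->
  sign_mean N A = sign_mean N B.
Proof.
move=> AB; apply: eq_bigr => b _; apply: eq_bigr => c _; congr (_ * `|_|).
by apply: eq_bigr => i _; apply: eq_bigr => j _; rewrite AB.
Qed.

(** The term a_{I,J} h_I(x) k_J(y) for the nodes I, J at levels n i, m j on the digit branches w, w'
    of x, y. *)
Definition twisted a (n m : nat -> nat) (w w' : nat -> bool) (i j : nat) : R :=
  a (cell w (n i), cell w' (m j)) * (sgn R (w (n i)) * sgn R (w' (m j))).

Definition square_mean a N n m (w w' : nat -> bool) : R :=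
  sign_mean N (twisted a n m w w').

(** At (x, y) only an N by N block of coefficients on the two digit branches survives, and
    [expectation_signs] makes the expectation a function of the digits alone. *)
Lemma Znorm_hsum M N n m a :
  (injective_below N n) ->
  (injective_below N m) ->
  supp_below M a ->
  (forall p, a p != 0 -> exists i j,
     [/\ (i < N)%N, (j < N)%N, level p.1 = n i & level p.2 = m j]) ->
  Znorm P X Y (hsum a) =
  X (step (fun w => Y (step (fun w' => square_mean a N n m w w')))).
Proof.
move=> ninj minj aM asupp; rewrite /Znorm (haar_coef_hsum aM).
(* X and Y receive functions on all of R, so the values outside [0, 1) have to vanish. *)
have E0 x y : ~ (unit_itv x /\ unit_itv y) ->
    fine ('E_P[fun s => `|\sum_(p \in [set: dyadic * dyadic])
      sgn R (s.1 p.1) * sgn R (s.2 p.2) * a p * haar p.1 x * haar p.2 y|]) = 0.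
  move=> nxy; rewrite (_ : (fun s => _) = cst 0) ?expectation_cst //.
  apply/funext => s /=; rewrite fsbig1 ?normr0 // => p _.
  rewrite !haarE; case: asboolP => [x01|_]; last by rewrite !(mul0r, mulr0).
  case: asboolP => [y01|_]; last by rewrite !(mul0r, mulr0).
  by case: nxy.
have E1 x y : unit_itv x -> unit_itv y ->
    fine ('E_P[fun s => `|\sum_(p \in [set: dyadic * dyadic])
      sgn R (s.1 p.1) * sgn R (s.2 p.2) * a p * haar p.1 x * haar p.2 y|]) =
    square_mean a N n m (digit x) (digit y).
  move=> x01 y01.
  pose H (b c : {ffun 'I_N -> bool}) : R := `|\sum_(i < N) \sum_(j < N)
    sgn R (b i) * sgn R (c j) * twisted a n m (digit x) (digit y) i j|.
  pose I (i : 'I_N) := cell (digit x) (n i).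
  pose J (i : 'I_N) := cell (digit y) (m i).
  rewrite (_ : (fun s => _) =
    fun s => H [ffun i => s.1 (I i)] [ffun j => s.2 (J j)]); last first.
    apply/funext => s; rewrite (@fsum_cells _ _ (digit x) (digit y) N n m) //.
      congr `| _ |; apply: eq_bigr => i _; apply: eq_bigr => j _ /=.
      rewrite !ffunE /twisted !haarE !asboolT // !level_cell !eqxx !mul1r.
      by rewrite -!mulrA.
    move=> p; rewrite !haarE !asboolT // => Fp.
    have ap : a p != 0 by apply: contraNneq Fp => ->; rewrite !(mulr0, mul0r).
    have [i [j [iN jN pi pj]]] := asupp _ ap.
    exists i, j; split => //; rewrite -pi -pj (surjective_pairing p) /=.
    congr pair; apply/eqP; apply: contraNT Fp => /negPf ->.
      by rewrite !(mul0r, mulr0).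
    by rewrite !(mul0r, mulr0).
  rewrite (expectation_signs hP) //.
  - exact: cell_level_inj.
  - exact: cell_level_inj.
  - by move=> b c; exact: normr_ge0.
congr hs_norm; apply/funext => x; rewrite /step; case: asboolP => x01; last first.
  (* Y 0 = 0 is homogeneity with scalar 0, applied to an element of V1. *)
  rewrite (_ : (fun y => _) = (0 : R) *: \1_(dset (cell (fun=> false) 0))).
    rewrite hs_normZ ?normr0 ?mul0r //.
    by exists 1%N, (fun=> 1), (fun=> \1_(dset (cell (fun=> false) 0))); split;
      [move=> _; exists (cell (fun=> false) 0)|rewrite big_ord1 scale1r].
  by apply/funext => y; rewrite E0 ?scale0r // => -[].
congr hs_norm; apply/funext => y; rewrite /step; case: asboolP => y01.
  exact: E1.
by apply: E0 => -[].
Qed.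

(** Pointwise, the terms of b are those of a at the rearranged point. The first variable is
    rearranged under X and, for each of its values, the second one under Y. *)
Lemma Znorm_phi M N n m tau tau' a b :
  (injective_below N n) ->
  (injective_below N m) ->
  supp_below N a -> supp_below M b ->
  (forall p, b p != 0 -> exists i j,
     [/\ (i < N)%N, (j < N)%N, level p.1 = n i & level p.2 = m j]) ->
  (forall w w' i j, (i < N)%N -> (j < N)%N ->
     twisted b n m w w' i j = twisted a id id (phi n tau w) (phi m tau' w') i j) ->
  Znorm P X Y (hsum b) = Znorm P X Y (hsum a).
Proof.
move=> ninj minj aN bM bsupp ba.
rewrite (Znorm_hsum ninj minj bM bsupp) (@Znorm_hsum N N id id) //; last first.
  move=> p ap; exists (level p.1), (level p.2).
  have /andP[] : (level p.1 < N)%N && (level p.2 < N)%N.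
    by apply: contraNT ap => /aN ->.
  by [].
pose Q w := Y (step (fun w' => square_mean a N id id w w')).
have dep w w1 w' w1' : (forall i, (i < N)%N -> w i = w1 i) ->
    (forall i, (i < N)%N -> w' i = w1' i) ->
    square_mean a N id id w w' = square_mean a N id id w1 w1'.
  move=> ww ww'; apply: eq_sign_mean => i j iN jN; rewrite /twisted ww // ww' //.
  have /cellP -> : forall l, (l < i)%N -> w l = w1 l.
    by move=> l li; rewrite ww // (ltn_trans li).
  have /cellP -> // : forall l, (l < j)%N -> w' l = w1' l.
  by move=> l li; rewrite ww' // (ltn_trans li).
transitivity (X (step (Q \o phi n tau))); last first.
  apply: hs_norm_step_phi ninj _ => w w1 ww1; congr (Y (step _)).
  by apply/funext => w'; exact: dep.
congr (X (step _)); apply/funext => w /=; rewrite /Q.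
rewrite -[RHS](@hs_norm_step_phi _ Y N m tau') //; last first.
  by move=> w' w1' ww'; exact: dep.
congr (Y (step _)); apply/funext => w' /=.
by apply: eq_sign_mean => i j iN jN; rewrite ba.
Qed.

End Isometry.

(** * Averaged multipliers and changes of level *)

Section Averaging.
Variables (R : realType) (r1 r2 : bool) (P : probability (signs * signs)%type R).
Hypothesis hP : haar_sign_measure r1 r2 P.
Variables X Y : haar_system_norm R.
Variables (Z : normedModType R) (e : {linear V2 R -> Z}).
Hypothesis he : forall f, `|e f| = Znorm P X Y f.
Implicit Types (a b : dyadic * dyadic -> R) (d : dyadic -> dyadic -> R).

Definition mult d a (p : dyadic * dyadic) : R := d p.1 p.2 * a p.

Lemma supp_mult N d a : supp_below N a -> supp_below N (mult d a).
Proof. by move=> aN p h; rewrite /mult aN // mulr0. Qed.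

Lemma hsum_sum N (T : finType) (a : T -> dyadic * dyadic -> R) :
  (forall t, supp_below N (a t)) ->
  hsum (fun p => \sum_t a t p) = \sum_t hsum (a t).
Proof.
move=> aN; rewrite (@hsumE _ N); last first.
  by move=> p h; rewrite big1 // => t _; exact: aN.
under eq_bigr do rewrite scaler_suml.
by rewrite exchange_big; apply: eq_bigr => t _; rewrite (hsumE (aN t)).
Qed.

Definition flip (t : nat -> bool) (I : dyadic) : dyadic :=
  cell (phi id t (word R I)) (level I).

Lemma level_flip t I : level (flip t I) = level I.
Proof. exact: level_cell. Qed.

Lemma flip_cell t w n : flip t (cell w n) = cell (phi id t w) n.
Proof.
rewrite /flip level_cell; apply/cellP => i iN.
by rewrite /phi word_cell.
Qed.

Lemma flipK t : involutive (flip t).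
Proof.
move=> I; rewrite -[RHS](cell_word R I) {2}/flip flip_cell.
by apply/cellP => i _; rewrite /phi -addbA addbb addbF.
Qed.

(** The coefficients of the translated function: translating the argument of a Haar function gives
    the Haar function of the translated interval, up to the sign of the digit of t at its level. *)
Definition flip_coef (t t' : nat -> bool) a (p : dyadic * dyadic) : R :=
  a (flip t p.1, flip t' p.2) * (sgn R (t (level p.1)) * sgn R (t' (level p.2))).

Lemma supp_flip N t t' a : supp_below N a -> supp_below N (flip_coef t t' a).
Proof. by move=> aN p h; rewrite /flip_coef aN ?mul0r // !level_flip. Qed.

Lemma Znorm_flip N t t' a : supp_below N a ->
  Znorm P X Y (hsum (flip_coef t t' a)) = Znorm P X Y (hsum a).
Proof.
move=> aN; have fN := supp_flip t t' aN.
apply: (@Znorm_phi R r1 r2 P hP X Y N N id id t t' _ _ _ _ aN fN) => //.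
  move=> p ap; exists (level p.1), (level p.2).
  have /andP[] : (level p.1 < N)%N && (level p.2 < N)%N.
    by apply: contraNT ap => /fN ->.
  by [].
move=> w w' i j _ _; rewrite /twisted /flip_coef /= !flip_cell !level_cell -mulrA.
congr (_ * _); rewrite /phi /sgn !signr_addb.
by rewrite mulrACA [_ ^+ t i * _]mulrC [_ ^+ t' j * _]mulrC.
Qed.

Variables (d : dyadic -> dyadic -> R) (K : R).
Hypothesis hK : forall N a, supp_below N a ->
  Znorm P X Y (hsum (mult d a)) <= K * Znorm P X Y (hsum a).

(** Conjugation by the translation: as [flip] is involutive, [flip_coef] turns the translated
    multiplier into d, and both norms are invariant. *)
Lemma Znorm_mult_flip N t t' a : supp_below N a ->
  Znorm P X Y (hsum (mult (fun I J => d (flip t I) (flip t' J)) a)) <=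
  K * Znorm P X Y (hsum a).
Proof.
move=> aN; rewrite -(Znorm_flip t t' (supp_mult _ aN)) -(Znorm_flip t t' aN).
apply: le_trans (hK (supp_flip t t' aN)); rewrite le_eqVlt; apply/orP; left.
apply/eqP; congr (Znorm _ _ _ (hsum _)); apply/funext => p.
by rewrite /mult /flip_coef /= !flipK -mulrA.
Qed.

Lemma avg_expect i j : avg d i j =
  expect i (fun w => expect j (fun w' => d (cell w i) (cell w' j))).
Proof.
rewrite /avg /expect.
rewrite -(@sum_word R i (fun w => (\sum_(v : {ffun 'I_j -> bool})
   d (cell w i) (cell (ext v) j)) / 2 ^+ j)); last first.
  by move=> w w' /cellP ->.
rewrite mulr_suml; apply: eq_bigr => k _.
rewrite -(@sum_word R j (fun w => d (cell (word R (dy k)) i) (cell w j))); last first.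
  by move=> w w' /cellP ->.
rewrite !mulr_suml; apply: eq_bigr => l _.
have -> : cell (word R (dy k)) i = dy k := cell_word R (dy k).
have -> : cell (word R (dy l)) j = dy l := cell_word R (dy l).
rewrite -[LHS]/((2 ^+ i)^-1 * (2 ^+ j)^-1 * d (dy k) (dy l)).
by rewrite mulrC [_^-1 * _^-1]mulrC mulrA.
Qed.

(** A random translate of a fixed cell is uniform on its level, also when more digits are drawn than
    the level uses. *)
Lemma expect_cell N i w (F : dyadic -> R) : (i <= N)%N ->
  expect N (fun t => F (cell (phi id t w) i)) = expect i (fun t => F (cell t i)).
Proof.
move=> iN; rewrite -(@expect_phi R N i id w).
- rewrite /expect; congr (_ / _); apply: eq_bigr => v _ /=; congr F.
  by apply/cellP => k _; rewrite /phi addbC.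
- by move=> k /leq_trans; apply.
- by [].
- by move=> u u' /cellP ->.
Qed.

(** The same N serves all I and J below level N, so one average over translations produces all
    relevant coefficients at once. *)
Lemma avg_flip N I J : (level I < N)%N -> (level J < N)%N ->
  avg d (level I) (level J) =
  expect N (fun t => expect N (fun t' => d (flip t I) (flip t' J))).
Proof.
move=> IN JN; rewrite avg_expect.
rewrite -(@expect_cell N (level I) (word R I) (fun I' => expect (level J)
  (fun w' => d I' (cell w' (level J))))) ?(ltnW IN) //.
congr (expect N _); apply/funext => t.
by rewrite -(@expect_cell N (level J) (word R J) (d (flip t I))) ?(ltnW JN).
Qed.

Lemma expect_pair N (F : (nat -> bool) -> (nat -> bool) -> R) :
  expect N (fun t => expect N (F t)) = 2 ^- N * 2 ^- N *
    \sum_(t : {ffun 'I_N -> bool} * {ffun 'I_N -> bool}) F (ext t.1) (ext t.2).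
Proof. by rewrite /expect -mulr_suml pair_big -mulrA mulrC. Qed.

Lemma Znorm_mult_avg N a : supp_below N a ->
  Znorm P X Y (hsum (mult (fun I J => avg d (level I) (level J)) a)) <=
  K * Znorm P X Y (hsum a).
Proof.
move=> aN.
pose T := ({ffun 'I_N -> bool} * {ffun 'I_N -> bool})%type.
pose c : R := 2 ^- N * 2 ^- N.
pose at_ (t : T) := mult (fun I J => d (flip (ext t.1) I) (flip (ext t.2) J)) a.
have atN t : supp_below N (at_ t) by exact: supp_mult.
have -> : mult (fun I J => avg d (level I) (level J)) a =
    fun p => c * (\sum_t at_ t p) + (fun=> 0) p.
  apply/funext => p; rewrite addr0.
  have [/andP[p1 p2]|h] := boolP ((level p.1 < N) && (level p.2 < N))%N; last first.
    by rewrite /mult aN // mulr0 big1 ?mulr0 // => t _; rewrite atN.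
  by rewrite /mult (avg_flip p1 p2) expect_pair mulr_sumr mulr_suml mulr_sumr;
    apply: eq_bigr => t _; rewrite mulrA.
have sN : supp_below N (fun p => \sum_t at_ t p).
  by move=> p h; rewrite big1 // => t _; rewrite atN.
rewrite (@hsumP _ N) //.
have -> : hsum (fun=> 0) = 0 :> V2 R.
  by rewrite (@hsumE _ N) // big1 // => p _; rewrite scale0r.
(* The triangle inequality is used in Z, through e. *)
rewrite addr0 (hsum_sum atN) -!he linearZ linear_sum normrZ.
have c0 : 0 <= c by rewrite mulr_ge0 // invr_ge0 exprn_ge0.
rewrite (ger0_norm c0).
apply: (@le_trans _ _ (c * \sum_(t : T) K * `|e (hsum a)|)).
  apply: ler_wpM2l => //; apply: le_trans (ler_norm_sum _ _ _) _.
  by apply: ler_sum => t _; rewrite !he; exact: (Znorm_mult_flip (ext t.1) (ext t.2) aN).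
rewrite sumr_const card_prod !card_ffun card_bool card_ord -[_ *+ _]mulr_natl mulrA.
have -> : c * (2 ^ N * 2 ^ N)%N%:R = 1.
  by rewrite natrM natrX mulrACA mulVf ?mulr1 // expf_neq0 ?pnatr_eq0.
by rewrite mul1r.
Qed.

(** The coefficients of f with its digits read at positions n and m. An interval of level n i
    inherits from the interval of level i whose address consists of its own address digits n 0, ...,
    n (i - 1); the sums over i and j only search for the rank of a level. *)
Definition spread N (n m : nat -> nat) a (p : dyadic * dyadic) : R :=
  \sum_(i < N) \sum_(j < N) ((level p.1 == n i) && (level p.2 == m j))%:R *
    a (cell (fun k => word R p.1 (n k)) i, cell (fun k => word R p.2 (m k)) j).

(** Monotonicity places the digits n k with k < i below level n i, where the interval determines
    them. *)
Definition increasing_below N (n : nat -> nat) :=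
  forall i j, (j < N)%N -> (i < j)%N -> (n i < n j)%N.

Lemma increasing_below_inj N n : increasing_below N n -> injective_below N n.
Proof.
move=> ninc i j iN jN nij; case: (ltngtP i j) => // ij.
  by have := ninc _ _ jN ij; rewrite nij ltnn.
by have := ninc _ _ iN ij; rewrite nij ltnn.
Qed.

Lemma spread_supp N n m a p : spread N n m a p != 0 -> exists i j,
  [/\ (i < N)%N, (j < N)%N, level p.1 = n i & level p.2 = m j].
Proof.
apply: contra_neqP => h; rewrite /spread big1 // => i _; rewrite big1 // => j _.
case: eqP => [h1|_]; last by rewrite mul0r.
case: eqP => [h2|_]; last by rewrite mul0r.
by case: h; exists i, j.
Qed.

Lemma spread_below N n m a : exists M, supp_below M (spread N n m a).
Proof.
exists (maxn (\max_(i < N) n i) (\max_(i < N) m i)).+1 => p; apply: contraNeq.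
move=> /spread_supp[i [j [iN jN -> ->]]]; rewrite !ltnS !leq_max.
rewrite (@leq_bigmax _ (fun i : 'I_N => n i) (Ordinal iN)).
by rewrite (@leq_bigmax _ (fun i : 'I_N => m i) (Ordinal jN)) orbT.
Qed.

Lemma Znorm_spread N n m a : increasing_below N n -> increasing_below N m ->
  supp_below N a -> Znorm P X Y (hsum (spread N n m a)) = Znorm P X Y (hsum a).
Proof.
move=> ninc minc aN; have [M bM] := spread_below N n m a.
have ninj := increasing_below_inj ninc; have minj := increasing_below_inj minc.
apply: (@Znorm_phi R r1 r2 P hP X Y M N n m (fun=> false) (fun=> false) _ _
  ninj minj aN bM); first by move=> p; exact: spread_supp.
move=> w w' i j iN jN; rewrite /twisted /phi !addbF; congr (_ * _).
rewrite /spread /= !level_cell (bigD1 (Ordinal iN)) //= (bigD1 (Ordinal jN)) //=.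
rewrite !eqxx mul1r big1 => [|k kj]; last first.
  rewrite eq_sym (_ : (m k == m j) = false) ?andbF ?mul0r //.
  by apply: contraNF kj => /eqP/(minj _ _ (ltn_ord k) jN) kj; apply/eqP/val_inj.
rewrite addr0 big1 ?addr0 => [|k ki]; last first.
  rewrite big1 // => l _.
  rewrite eq_sym (_ : (n k == n i) = false) ?mul0r //.
  by apply: contraNF ki => /eqP/(ninj _ _ (ltn_ord k) iN) ki; apply/eqP/val_inj.
congr (a (_, _)); apply/cellP => k ki.
  by rewrite addbF word_cell // ninc.
by rewrite addbF word_cell // minc.
Qed.

(** An averaged multiplier depends on levels only and is therefore intertwined by [spread]; this is
    why averaging precedes the change of levels. *)
Lemma Znorm_mult_spread N n m a : increasing_below N n -> increasing_below N m ->
  supp_below N a ->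
  Znorm P X Y (hsum (mult (fun I J => avg d (n (level I)) (m (level J))) a)) <=
  K * Znorm P X Y (hsum a).
Proof.
move=> ninc minc aN; have [M bM] := spread_below N n m a.
rewrite -(Znorm_spread ninc minc aN) -(Znorm_spread ninc minc (supp_mult _ aN)).
apply: le_trans (Znorm_mult_avg bM); rewrite le_eqVlt; apply/orP; left; apply/eqP.
congr (Znorm _ _ _ (hsum _)); apply/funext => p.
rewrite /spread /mult mulr_sumr; apply: eq_bigr => i _.
rewrite mulr_sumr; apply: eq_bigr => j _ /=; rewrite !level_cell.
case: eqP => [->|_]; last by rewrite !(mul0r, mulr0).
case: eqP => [->|_]; last by rewrite !(mul0r, mulr0).
by rewrite !mul1r.
Qed.

(* A finitely supported f is fixed, so entrywise closeness of the coefficients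
   is enough. *)
Lemma Znorm_mult_limit N a s : supp_below N a ->
  (forall eps, 0 < eps -> exists n m, [/\ increasing_below N n, increasing_below N m &
     forall I J, (level I < N)%N -> (level J < N)%N ->
       `|s I J - avg d (n (level I)) (m (level J))| <= eps]) ->
  Znorm P X Y (hsum (mult s a)) <= K * Znorm P X Y (hsum a).
Proof.
move=> aN hs.
pose L := \sum_(p <- grid N) `|a p| * `|e (hk p)|.
have L0 : 0 <= L by apply: sumr_ge0 => p _; rewrite mulr_ge0.
apply/ler_addgt0Pr => eps eps0.
(* L controls the effect of a uniform coefficient error; the added 1 covers L = 0. *)
have eL : 0 < eps / (L + 1) by rewrite divr_gt0 // ltr_wpDl.
have [n [m [ninc minc close]]] := hs _ eL.
pose T I J := avg d (n (level I)) (m (level J)).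
have -> : mult s a = fun p => 1 * mult T a p + mult (fun I J => s I J - T I J) a p.
  by apply/funext => p; rewrite /mult mul1r -mulrDl addrC subrK.
rewrite (@hsumP _ N); [|exact: supp_mult|exact: supp_mult].
rewrite scale1r -he linearD (le_trans (ler_normD _ _)) // lerD //.
  by rewrite he; exact: (Znorm_mult_spread ninc minc aN).
rewrite (hsumE (supp_mult _ aN)) linear_sum (le_trans (ler_norm_sum _ _ _)) //.
apply: (@le_trans _ _ (eps / (L + 1) * L)).
  rewrite mulr_sumr big_seq [leRHS]big_seq; apply: ler_sum => p.
  rewrite mem_grid => /andP[p1 p2]; rewrite linearZ normrZ /mult normrM -[leLHS]mulrA.
  by apply: ler_wpM2r; [rewrite mulr_ge0|exact: close].
by rewrite mulrAC ler_pdivrMr ?ltr_wpDl // ler_wpM2l ?(ltW eps0) // lerDl.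
Qed.

End Averaging.

(** * Iterated limits along the ultrafilter *)

Section Ultralimits.
Variables (R : realType) (U : set_system nat).
Hypotheses (hU : UltraFilter U) (hUn : nonprincipal U).

Let PU : ProperFilter U := ultra_proper.

Lemma ultra_fmap (T : Type) (v : nat -> T) : UltraFilter (v @ U).
Proof.
split; first exact: fmap_proper_filter.
move=> G GF vUG; apply/seteqP; split=> // A GA.
have [//|nA] := in_ultra_setVsetC (v @^-1` A) hU.
have GnA : G (~` A) by apply: vUG; rewrite /nbhs /= preimage_setC.
by have /filter_ex[x []] : G (A `&` ~` A) by exact: filterI.
Qed.

(** [lim] is meaningful only for convergent families; compactness of [-B, B] supplies convergence
    along U. *)
Lemma ultra_bounded_cvg (v : nat -> R) (B : R) :
  (forall i, `|v i| <= B) -> cvg (v @ U).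
Proof.
move=> vB; have := @segment_compact R (- B) B; rewrite compact_ultra.
move=> /(_ (v @ U) (ultra_fmap v)) [|l [_ vl]].
  change (U (v @^-1` [set` `[- B, B]])).
  by apply: filterE => i /=; rewrite in_itv /= -ler_norml.
by apply/cvg_ex; exists l.
Qed.

Lemma ultra_lim_le (v : nat -> R) (B : R) :
  (forall i, `|v i| <= B) -> `|lim (v @ U)| <= B.
Proof.
move=> vB; have vc := ultra_bounded_cvg vB.
rewrite ler_norml; apply/andP; split.
  apply: limr_ge => //; apply: filterE => i.
  by have := vB i; rewrite ler_norml => /andP[].
apply: limr_le => //; apply: filterE => i.
by have := vB i; rewrite ler_norml => /andP[].
Qed.

(** An ultrafilter containing a singleton is principal, so U contains the complement of every
    point. *)
Lemma nonprincipal_gt k : U [set n | (k < n)%N].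
Proof.
have single n : U (~` [set n]).
  have [Un|//] := in_ultra_setVsetC [set n] hU.
  case: (@hUn n); apply/esym/(@max_filter _ _ hU).
    exact: principal_filter_proper.
  move=> A UA; apply/principal_filterP.
  by have /filter_ex[x [Ax <-]] : U (A `&` [set n]) by exact: filterI.
elim: k => [|k IH].
  by apply: filterS (single 0%N) => n /= n0; rewrite lt0n; apply/eqP.
have : U ([set n | (k < n)%N] `&` ~` [set k.+1]) by exact: filterI.
apply: filterS => n /= [kn nk].
by rewrite ltn_neqAle kn andbT eq_sym; apply/eqP.
Qed.

(* The indices are chosen in the order m 0, n 0, m 1, n 1, and so on. *)
Lemma interlace (u : nat -> nat -> R) (L M : nat -> R) (l mu : R) :
  (forall j, u i j @[i --> U] --> L j) -> L j @[j --> U] --> l ->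
  (forall i, u i j @[j --> U] --> M i) -> M i @[i --> U] --> mu ->
  forall eps, 0 < eps -> forall N, exists n m,
    [/\ increasing_below N n, increasing_below N m &
     forall i j, (i < N)%N -> (j < N)%N ->
       `|(if (j <= i)%N then l else mu) - u (n i) (m j)| <= eps].
Proof.
move=> uL Ll uM Mmu eps eps0 N; have e2 : 0 < eps / 2 by rewrite divr_gt0.
(* One half of eps is spent on each of the two nested limits. The limits L and M at the chosen
   indices stay in the invariant because later indices are compared with them. *)
suff [n [m [ninc minc [nM mL near_]]]] : exists n m,
    [/\ increasing_below N n, increasing_below N m &
    [/\ forall i, (i < N)%N -> `|mu - M (n i)| < eps / 2,
        forall j, (j < N)%N -> `|l - L (m j)| < eps / 2 &
        forall i j, (i < N)%N -> (j < N)%N ->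
       `|(if (j <= i)%N then L (m j) else M (n i)) - u (n i) (m j)| < eps / 2]].
  exists n, m; split=> // i j iN jN; have := near_ _ _ iN jN.
  have := nM _ iN; have := mL _ jN; rewrite [eps in _ <= eps]splitr.
  case: ifP => _ h1 h2 h3.
    by rewrite (le_trans (ler_distD (L (m j)) _ _)) // lerD // ltW.
  by rewrite (le_trans (ler_distD (M (n i)) _ _)) // lerD // ltW.
elim: N => [|N [n [m [ninc minc [nM mL near_]]]]].
  by exists id, id.
pose extend (s : nat -> nat) k i := if i == N then k else s i.
have extN s k : extend s k N = k by rewrite /extend eqxx.
have extE_ s k i : (i < N)%N -> extend s k i = s i.
  by move=> iN; rewrite /extend ltn_eqF.
have ext_inc s k : increasing_below N s -> (forall i, (i < N)%N -> (s i < k)%N) ->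
    increasing_below N.+1 (extend s k).
  move=> sinc sk i j; rewrite ltnS leq_eqVlt => /orP[/eqP -> iN|jN ij].
    by rewrite extN extE_ ?sk.
  by rewrite !extE_ ?sinc // (ltn_trans ij).
have big s : U [set k | forall i : 'I_N, (s i < k)%N].
  by apply: filter_forall => i; exact: nonprincipal_gt.
(* The new column: at the pairs (i, N) with i < N the target is mu, so u (n i) b must be near M (n
   i). *)
have /filter_ex[b /= [bm [bL bM]]] : U ([set k | forall i : 'I_N, (m i < k)%N] `&`
    ([set k | `|l - L k| < eps / 2] `&`
     [set k | forall i : 'I_N, `|M (n i) - u (n i) k| < eps / 2])).
  apply: filterI; first exact: big.
  apply: filterI; first exact: (cvgr_dist_lt _ _ Ll _ e2).
  by apply: filter_forall => i; exact: (cvgr_dist_lt _ _ (uM _) _ e2).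
pose m' := extend m b.
(* The new row is compared with all columns j <= N, the one just chosen included: the diagonal
   belongs to l, as |I| = |J| belongs to the Capon projection. *)
have /filter_ex[a /= [an [aM aL]]] : U ([set k | forall i : 'I_N, (n i < k)%N] `&`
    ([set k | `|mu - M k| < eps / 2] `&`
     [set k | forall j : 'I_N.+1, `|L (m' j) - u k (m' j)| < eps / 2])).
  apply: filterI; first exact: big.
  apply: filterI; first exact: (cvgr_dist_lt _ _ Mmu _ e2).
  by apply: filter_forall => j; exact: (cvgr_dist_lt _ _ (uL _) _ e2).
exists (extend n a), m'; split.
- by apply: ext_inc => // i iN; exact: (an (Ordinal iN)).
- by apply: ext_inc => // i iN; exact: (bm (Ordinal iN)).
split.
- by move=> i; rewrite ltnS leq_eqVlt => /orP[/eqP ->|iN]; rewrite ?extN // extE_ ?nM.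
- by move=> i; rewrite ltnS leq_eqVlt => /orP[/eqP ->|iN]; rewrite /m' ?extN // extE_ ?mL.
move=> i j; rewrite ltnS leq_eqVlt => /orP[/eqP ->|iN] jN.
  by rewrite -ltnS jN extN; exact: (aL (Ordinal jN)).
rewrite (extE_ n) //; move: jN; rewrite ltnS leq_eqVlt => /orP[/eqP ->|jN].
  by rewrite leqNgt iN /= /m' extN; exact: (bM (Ordinal iN)).
by rewrite /m' extE_ //; exact: near_.
Qed.

End Ultralimits.

(** * Extension of a bounded operator to the completion *)

Section Extension.
Variables (R : realType) (E : lmodType R) (Z : completeNormedModType R).
Variables (e : {linear E -> Z}) (g : E -> Z) (K : R).
Hypotheses (e_dense : dense (range e)) (g_linear : linear g) (K0 : 0 <= K).
Hypothesis g_le : forall f, `|g f| <= K * `|e f|.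

Let gB f h : g (f - h) = g f - g h.
Proof. by rewrite addrC -scaleN1r g_linear scaleN1r addrC. Qed.

(** The closure of the set of pairs (e f, g f); it is the graph of the extension once it is shown to
    be single-valued and total. *)
Let close z y := forall eps, 0 < eps ->
  exists f, `|z - e f| < eps /\ `|y - g f| < eps.

Let close_fun z y y' : close z y -> close z y' -> y = y'.
Proof.
move=> zy zy'; apply/eqP; rewrite -subr_eq0 -normr_le0.
apply/ler_addgt0Pr => eps eps0; rewrite add0r.
(* With D this quotient, the approximations of y and y' cost 2 D and the bound on g costs 2 K D, in
   total eps. *)
have d0 : 0 < eps / (2 * (K + 1)) by rewrite divr_gt0 // mulr_gt0 // ltr_wpDl.
have [f [zf yf]] := zy _ d0; have [h [zh yh]] := zy' _ d0.
have -> : y - y' = (y - g f) + (g (f - h) - (y' - g h)).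
  by rewrite gB opprB !subrKA.
have efh : `|e (f - h)| <= `|z - e f| + `|z - e h|.
  by rewrite linearB [`|z - e f|]distrC (le_trans _ (ler_normD _ _)) // addrA subrK.
have := g_le (f - h).
have := ler_normD (y - g f) (g (f - h) - (y' - g h)).
have := ler_normB (g (f - h)) (y' - g h).
move: zf yf zh yh efh; set D := eps / _.
have -> : eps = D * (2 * (K + 1)) by rewrite /D divfK // mulf_neq0 // gt_eqF // ltr_wpDl.
move=> zf yf zh yh efh h1 h2 h3.
have : K * `|e (f - h)| <= K * (D + D).
  by apply: ler_wpM2l => //; lra.
lra.
Qed.

Let approx z eps : 0 < eps -> exists f, `|z - e f| < eps.
Proof.
move=> eps0; have [] := @e_dense (ball z eps).
- by exists z; exact: ballxx.
- exact: ball_open.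
- by move=> w [zw [f _ fw]]; exists f; move: zw; rewrite -ball_normE /= fw.
Qed.

Let close_total z : exists y, close z y.
Proof.
have approx_n n : exists f, `|z - e f| < n.+1%:R^-1 by exact: approx.
have [f fz] := choice approx_n.
have /cvg_ex[y fy] : cvg ((g \o f) @ \oo).
  apply/cauchy_cvgP/cauchy_exP => eps eps0.
  have d0 : 0 < eps / (2 * (K + 1)) by rewrite divr_gt0 // mulr_gt0 // ltr_wpDl.
  have [N _ hN] := near_infty_natSinv_lt (PosNum d0).
  exists (g (f N)); exists N => // m /= Nm; rewrite -ball_normE /= -gB.
  have h1 := lt_trans (fz _) (hN _ (leqnn N)); have h2 := lt_trans (fz _) (hN _ Nm).
  have efh : `|e (f N - f m)| <= `|z - e (f N)| + `|z - e (f m)|.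
    by rewrite linearB [`|z - e (f N)|]distrC (le_trans _ (ler_normD _ _)) // addrA subrK.
  have := g_le (f N - f m); move: h1 h2 => /=; set D := eps / _.
  have -> : eps = D * (2 * (K + 1)) by rewrite /D divfK // mulf_neq0 // gt_eqF // ltr_wpDl.
  move=> h1 h2 h3.
  have : K * `|e (f N - f m)| <= K * (D + D) by apply: ler_wpM2l => //; lra.
  have : 0 < D by rewrite divr_gt0 // mulr_gt0 // ltr_wpDl.
  lra.
exists y => eps eps0.
have /filter_ex[n [h1 h2]] :
    \forall n \near \oo, (n.+1%:R^-1 < eps) /\ `|y - (g \o f) n| < eps.
  apply: filterI; first exact: (near_infty_natSinv_lt (PosNum eps0)).
  exact: (cvgr_dist_lt _ _ fy _ eps0).
by exists (f n); split=> //; exact: lt_trans (fz n) h1.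
Qed.

Let close_linear c z z' y y' :
  close z y -> close z' y' -> close (c *: z + z') (c *: y + y').
Proof.
move=> zy zy' eps eps0.
have d0 : 0 < eps / (`|c| + 1) by rewrite divr_gt0 // ltr_wpDl.
have [f [zf yf]] := zy _ d0; have [h [zh yh]] := zy' _ d0.
have dE : eps = `|c| * (eps / (`|c| + 1)) + eps / (`|c| + 1).
  by rewrite -[X in _ + X]mul1r -mulrDl mulrC divfK // gt_eqF // ltr_wpDl.
exists (c *: f + h); rewrite linearP g_linear.
by split; rewrite opprD addrACA -scalerBr dE; apply: le_lt_trans (ler_normD _ _) _;
  rewrite normrZ ler_ltD // ler_wpM2l // ltW.
Qed.

Lemma dense_extension : exists C : {linear Z -> Z},
  (forall f, C (e f) = g f) /\ (forall z, `|C z| <= K * `|z|).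
Proof.
have [C hC] := choice close_total.
have Clin : linear C.
  by move=> c z z'; apply: close_fun (hC _) _; exact: close_linear.
pose CL : {linear Z -> Z} := HB.pack C (GRing.isLinear.Build R Z Z *:%R C Clin).
exists CL; split=> [f|z].
  by apply: close_fun (hC _) _ => eps eps0; exists f; rewrite !subrr normr0.
apply/ler_addgt0Pr => eps eps0.
have d0 : 0 < eps / (K + 1) by rewrite divr_gt0 // ltr_wpDl.
have [f [zf yf]] := hC z _ d0; have -> : CL z = C z by [].
have h1 := ler_normD (C z - g f) (g f); rewrite subrK in h1.
have h2 := ler_normB z (z - e f); rewrite subKr in h2.
have := g_le f; move: zf yf; set D := eps / _.
have -> : eps = D * (K + 1) by rewrite /D divfK // gt_eqF // ltr_wpDl.
move=> h3 h4 h5.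
have : K * `|e f| <= K * (`|z| + D) by apply: ler_wpM2l => //; lra.
lra.
Qed.

End Extension.

(** * Operator norms for homogeneous functionals *)

Section OperatorNorm.
Variables (R : realType) (V W : lmodType R) (N : V -> R) (M : W -> R) (T : V -> W).
Hypotheses (NZ : forall c f, N (c *: f) = `|c| * N f)
  (MZ : forall c f, M (c *: f) = `|c| * M f)
  (TZ : forall c f, T (c *: f) = c *: T f)
  (N0 : forall f, 0 <= N f).

Lemma opnorm_ge0 : (0 <= opnorm N M T)%E.
Proof.
apply: ereal_sup_ubound; exists 0; last first.
  by rewrite -[in T _](scale0r 0) TZ MZ normr0 mul0r.
by rewrite /= -(scale0r 0) NZ normr0 mul0r.
Qed.

Lemma opnorm_bound K : (opnorm N M T <= K%:E)%E -> forall f, M (T f) <= K * N f.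
Proof.
move=> hK f.
have unit_ball h : N h <= 1 -> M (T h) <= K.
  by move=> h1; rewrite -lee_fin; apply: le_trans hK; apply: ereal_sup_ubound; exists h.
have K0 : 0 <= K by rewrite -lee_fin; apply: le_trans opnorm_ge0 hK.
have := N0 f; rewrite le_eqVlt => /orP[/eqP f0|f0]; last first.
  have := unit_ball ((N f)^-1 *: f); rewrite NZ TZ MZ.
  rewrite ger0_norm ?invr_ge0 // mulVf ?gt_eqF // => /(_ (lexx _)).
  by rewrite mulrC ler_pdivrMr.
rewrite -f0 mulr0 leNgt; apply/negP => Tf0.
(* When N f = 0, all multiples of f stay in the unit ball, and the image of this one has norm K +
   1. *)
have := unit_ball (((K + 1) / M (T f)) *: f); rewrite NZ TZ MZ -f0 mulr0 => /(_ ler01).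
rewrite ger0_norm ?divfK ?gt_eqF //; first by lra.
by rewrite divr_ge0 ?ltW // ltr_wpDl.
Qed.

Lemma opnorm_le K : 0 <= K -> (forall f, M (T f) <= K * N f) -> (opnorm N M T <= K%:E)%E.
Proof.
move=> K0 hT; apply: ge_ereal_sup => _ [f f1 <-]; rewrite lee_fin (le_trans (hT f)) //.
by rewrite -[leRHS]mulr1 ler_wpM2l.
Qed.

End OperatorNorm.

(** * Bounds on averages, and the averages of the Capon coefficients *)

Lemma expect_cst (R : realType) M (c : R) : expect M (fun=> c) = c.
Proof.
rewrite /expect sumr_const card_ffun card_bool card_ord -[_ *+ _]mulr_natl natrX.
by rewrite mulrAC mulfV ?mul1r // expf_neq0 ?pnatr_eq0.
Qed.

Lemma expect_norm_le (R : realType) M (G : (nat -> bool) -> R) (B : R) :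
  (forall w, `|G w| <= B) -> `|expect M G| <= B.
Proof.
move=> GB; rewrite -(expect_cst M B) /expect normrM.
rewrite [`|_^-1|]ger0_norm ?invr_ge0 ?exprn_ge0 //.
rewrite ler_wpM2r ?invr_ge0 ?exprn_ge0 //.
by apply: le_trans (ler_norm_sum _ _ _) _; apply: ler_sum.
Qed.

Lemma avg_norm_le (R : realType) (d : dyadic -> dyadic -> R) (B : R) :
  (forall I J, `|d I J| <= B) -> forall i j, `|avg d i j| <= B.
Proof.
by move=> dB i j; rewrite avg_expect; apply: expect_norm_le => w; exact: expect_norm_le.
Qed.

Lemma capon_coefE (R : realType) I J : capon_coef R I J = (level J <= level I)%N%:R.
Proof.
rewrite /capon_coef /dlen lef_pV2 ?posrE ?exprn_gt0 // ler_eXn2l ?ltr1n //.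
by case: ifP.
Qed.

Lemma avg_capon (R : realType) i j : avg (capon_coef R) i j = (j <= i)%N%:R.
Proof.
rewrite avg_expect -[RHS](expect_cst i); congr (expect i _); apply/funext => w.
rewrite -[RHS](expect_cst j); congr (expect j _); apply/funext => w'.
by rewrite capon_coefE !level_cell.
Qed.

(** * The Capon estimate and norms of single Haar functions *)

Section CaponBound.
Variables (R : realType) (U : set_system nat).
Hypotheses (hU : UltraFilter U) (hUn : nonprincipal U).

Let PU : ProperFilter U := ultra_proper.

(** For fixed j the average is 1 once i >= j, which holds on a set of U. *)
Lemma lambda_capon : lambda_fun U (capon_coef R) = 1.
Proof.
rewrite /lambda_fun (_ : (fun j => _) = cst 1); first exact: lim_cst.
apply/funext => j; apply: cvg_lim => //; apply: cvg_near_cst.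
apply: filterS (nonprincipal_gt hU hUn j) => i /ltnW ji.
by rewrite avg_capon ji.
Qed.

Lemma mu_capon : mu_fun U (capon_coef R) = 0.
Proof.
rewrite /mu_fun (_ : (fun i => _) = cst 0); first exact: lim_cst.
apply/funext => i; apply: cvg_lim => //; apply: cvg_near_cst.
apply: filterS (nonprincipal_gt hU hUn i) => j /= ij.
by rewrite avg_capon leqNgt ij.
Qed.

Variables (r1 r2 : bool) (P : probability (signs * signs)%type R).
Hypothesis hP : haar_sign_measure r1 r2 P.
Variables X Y : haar_system_norm R.
Variables (Z : normedModType R) (e : {linear V2 R -> Z}).
Hypothesis he : forall f, `|e f| = Znorm P X Y f.

Lemma capon_bound (d : dyadic -> dyadic -> R) (K B : R) :
  (forall N a, supp_below N a ->
     Znorm P X Y (hsum (mult d a)) <= K * Znorm P X Y (hsum a)) ->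
  (forall I J, `|d I J| <= B) ->
  forall f, `|lambda_fun U d - mu_fun U d| * Znorm P X Y (capon f) <=
    (K + B) * Znorm P X Y f.
Proof.
move=> hK dB f; have [N [aN fE]] := V2_hsum f; set a := haar_coef f in aN fE.
set l := lambda_fun U d; set mu := mu_fun U d.
have avgB := avg_norm_le dB.
pose L j := lim (avg d i j @[i --> U]); pose M i := lim (avg d i j @[j --> U]).
have uL j : avg d i j @[i --> U] --> L j.
  by apply: (ultra_bounded_cvg hU (B := B)) => i.
have uM i : avg d i j @[j --> U] --> M i.
  by apply: (ultra_bounded_cvg hU (B := B)) => j.
have LB j : `|L j| <= B by apply: ultra_lim_le => // i.
have MB i : `|M i| <= B by apply: ultra_lim_le => // j.
have muB : `|mu| <= B by exact: (ultra_lim_le hU MB).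
pose s I J : R := if (level J <= level I)%N then l else mu.
have sK : Znorm P X Y (hsum (mult s a)) <= K * Znorm P X Y (hsum a).
  (* The support bound N of f is the number of levels to interlace. *)
  apply: (Znorm_mult_limit hP he hK aN) => eps eps0.
  have [n [m [ninc minc close]]] := interlace hU hUn uL
    (ultra_bounded_cvg hU LB) uM (ultra_bounded_cvg hU MB) eps0 N.
  by exists n, m; split => // I J; exact: close.
have -> : capon f = hsum (mult (capon_coef R) a) by [].
have sE : hsum (mult s a) = (l - mu) *: hsum (mult (capon_coef R) a) + mu *: hsum a.
  have cN := supp_mult (capon_coef R) aN.
  have mN : supp_below N (fun p => mu * a p + (fun=> 0) p).
    by move=> p h; rewrite aN // mulr0 addr0.
  have zE : mu *: hsum a = hsum (fun p => mu * a p + (fun=> 0) p).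
    rewrite (hsumP mu aN (b := fun=> 0)) // (@hsumE _ N (fun=> 0)) //.
    by rewrite big1 ?addr0 // => p _; rewrite scale0r.
  rewrite zE -(hsumP _ cN mN); congr hsum; apply/funext => p.
  by rewrite /mult /s capon_coefE; case: leqP => _ /=; ring.
have -> : `|l - mu| * Znorm P X Y (hsum (mult (capon_coef R) a)) =
    `|e (hsum (mult s a)) - mu *: e (hsum a)|.
  by rewrite -he -normrZ sE linearP [e (mu *: _)]linearZ addrK.
apply: le_trans (ler_normB _ _) _.
rewrite he mulrDl fE lerD // normrZ he -/a.
by rewrite ler_wpM2r // -he.
Qed.

(** The target is general in order to cover operators on V(delta^2), with E the identity, and
    operators on Z, with E = e. *)
Lemma mult_linear (V : lmodType R) (E : {linear V2 R -> V}) (D : {linear V -> V}) d :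
  haar_multiplier (E \o hk) D d ->
  forall N a, supp_below N a -> D (E (hsum a)) = E (hsum (mult d a)).
Proof.
move=> hD N a aN; rewrite (hsumE aN) (hsumE (supp_mult d aN)) !linear_sum.
apply: eq_bigr => -[I J] _; rewrite !linearZ -[E (hk _)]/((E \o hk) (I, J)) hD /=.
by rewrite scalerA mulrC.
Qed.

Lemma haar_norm I x : `|haar I x| = \1_(dset I) x :> R.
Proof.
rewrite haarE indicE; case: asboolP => [x01|nx]; last first.
  by rewrite mul0r normr0 memNset // => /dset_unit.
have -> : (x \in dset I) = (I == cell (digit x) (level I)).
  by apply/idP/eqP; rewrite inE => /(dset_cell _ x01).
by rewrite mul1r normrM normr_nat /sgn normrX normrN1 expr1n mulr1.
Qed.

(** Nonnegativity follows from the triangle inequality for f and -f. *)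
Lemma hs_norm_ge0 (W : haar_system_norm R) f : V1 f -> 0 <= W f.
Proof.
move=> Vf; have V0 : V1 (0 *: f).
  have [n [c [g [hg fE]]]] := Vf; exists n, (fun=> 0), g; split=> //.
  by rewrite scale0r big1 // => i _; rewrite scale0r.
have VN : V1 (-1 *: f).
  have [n [c [g [hg fE]]]] := Vf; exists n, (fun i => -1 * c i), g; split=> //.
  by rewrite fE scaler_sumr; apply: eq_bigr => i _; rewrite scalerA.
have := hs_normD W Vf VN; rewrite hs_normZ // normrN1 mul1r scaleN1r subrr.
by rewrite -(scale0r f) hs_normZ // normr0 mul0r -mulr2n pmulrn_lge0.
Qed.

Lemma V1_dset I : V1 (\1_(dset I) : R -> R).
Proof.
exists 1%N, (fun=> 1), (fun=> \1_(dset I)); split; first by move=> _; exists I.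
by rewrite big_ord1 scale1r.
Qed.

Lemma supp_below_pick (c : dyadic * dyadic -> R) p :
  supp_below (maxn (level p.1) (level p.2)).+1 (fun q => c q * (q == p)%:R).
Proof.
move=> q; apply: contraNeq; case: (q =P p) => [-> _|_]; last by rewrite mulr0 eqxx.
by rewrite !ltnS leq_maxl leq_maxr.
Qed.

Lemma hsum_pick (c : dyadic * dyadic -> R) p :
  hsum (fun q => c q * (q == p)%:R) = c p *: hk p.
Proof.
rewrite /hsum (@fsum_seq _ _ [:: p]) ?big_seq1 ?eqxx ?mulr1 // => q.
by rewrite inE => /negPf ->; rewrite mulr0 scale0r.
Qed.

Lemma haar_coef_hk p : haar_coef (hk p : V2 R) = fun q => (q == p)%:R.
Proof.
rewrite -[hk p]scale1r -(hsum_pick (fun=> 1)) (haar_coef_hsum (@supp_below_pick _ p)).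
by apply/funext => q; rewrite mul1r.
Qed.

Lemma hs_norm_dset_gt0 (W : haar_system_norm R) I : 0 < W (\1_(dset I)).
Proof.
rewrite lt_neqAle hs_norm_ge0 ?andbT; last exact: V1_dset.
apply/eqP => /esym /(hs_norm0_eq0 (V1_dset I)) /(congr1 (fun f => f (lpt R I))).
rewrite /= indicE mem_set; last exact: dset_lpt.
by move/eqP; rewrite oner_eq0.
Qed.

(** All signs disappear under the absolute value, so the norm factors; in particular it is
    positive. *)
Lemma Znorm_hk p : Znorm P X Y (hk p) = Y (\1_(dset p.2)) * X (\1_(dset p.1)).
Proof.
rewrite /Znorm haar_coef_hk.
have E x y : fine ('E_P[fun s => `|\sum_(q \in [set: dyadic * dyadic])
    sgn R (s.1 q.1) * sgn R (s.2 q.2) * (q == p)%:R * haar q.1 x * haar q.2 y|]) =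
    \1_(dset p.1) x * \1_(dset p.2) y.
  rewrite (_ : (fun s => _) = cst (\1_(dset p.1) x * \1_(dset p.2) y)).
    by rewrite expectation_cst.
  apply/funext => s /=; rewrite (@fsum_seq _ _ [:: p]) //; last first.
    by move=> q; rewrite inE => /negPf ->; rewrite mulr0 !mul0r.
  rewrite big_seq1 eqxx mulr1 !normrM !haar_norm /sgn !normrX normrN1 !expr1n.
  by rewrite !mul1r.
rewrite (_ : (fun x => _) = Y (\1_(dset p.2)) *: \1_(dset p.1)).
  rewrite hs_normZ; last exact: V1_dset.
  by rewrite ger0_norm // hs_norm_ge0 //; exact: V1_dset.
apply/funext => x; rewrite (_ : (fun y => _) = \1_(dset p.1) x *: \1_(dset p.2)).
  rewrite hs_normZ; last exact: V1_dset.
  by rewrite indicE normr_nat mulrC.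
by apply/funext => y; rewrite E.
Qed.

Lemma capon_hk p : capon (hk p) = capon_coef R p.1 p.2 *: hk p.
Proof.
rewrite /capon /diag_op haar_coef_hk.
exact: (hsum_pick (fun q => capon_coef R q.1 q.2)).
Qed.

(** h_I \otimes k_J is an eigenvector of positive norm. Hence a finite operator norm forces a finite
    sup norm. *)
Lemma multiplier_coef_le (d : dyadic -> dyadic -> R) (K : R) :
  (forall N a, supp_below N a ->
     Znorm P X Y (hsum (mult d a)) <= K * Znorm P X Y (hsum a)) ->
  forall I J, `|d I J| <= K.
Proof.
move=> hK I J; have := hK _ _ (@supp_below_pick (fun=> 1) (I, J)).
rewrite hsum_pick scale1r (_ : mult d _ = fun q => d q.1 q.2 * (q == (I, J))%:R).
  rewrite (hsum_pick (fun q => d q.1 q.2)) -!he linearZ normrZ he.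
  by rewrite ler_pM2r // Znorm_hk mulr_gt0 // hs_norm_dset_gt0.
by apply/funext => q; rewrite /mult mul1r.
Qed.

Lemma capon_linear (V : lmodType R) (E : {linear V2 R -> V}) :
  linear (fun f => E (capon f)).
Proof.
move=> c f g; rewrite -linearP; congr (E _).
have [N [fN _]] := V2_hsum f; have [M [gM _]] := V2_hsum g.
have {}fN := supp_mult (capon_coef R) (supp_belowS (leq_maxl N M) fN).
have {}gM := supp_mult (capon_coef R) (supp_belowS (leq_maxr N M) gM).
have cE h : capon h = hsum (mult (capon_coef R) (haar_coef h)) by [].
rewrite !cE -(hsumP c fN gM); congr hsum; apply/funext => p.
by rewrite /mult haar_coefP; ring.
Qed.

End CaponBound.

(** * The quotient estimate and the boundedness criterion *)

Lemma T2S_ge0 (R : realType) (d : dyadic -> dyadic -> R) : (0 <= T2S d)%E.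
Proof.
have max0 i j (F : dyadic -> dyadic -> R) : (forall I J, 0 <= F I J) -> 0 <= max_over i j F.
  move=> F0; rewrite /max_over; elim/big_ind : _ => // [x y x0 y0|I _].
    by rewrite le_max x0.
  by elim/big_ind : _ => // x y x0 y0; rewrite le_max x0.
have sign0 (F : bool -> R) : (forall w, 0 <= F w) -> 0 <= max_sign F.
  by move=> F0; rewrite /max_sign; elim/big_ind : _ => // x y x0 y0; rewrite le_max x0.
by rewrite /T2S !adde_ge0 //; apply: nneseries_ge0 => k _ _; rewrite lee_fin;
  [apply: mulr_ge0 => //|apply: mulr_ge0 => //|apply: sumr_ge0 => l _
  |apply: sumr_ge0 => l _]; apply: max0 => I J; apply/sign0 => w //; apply/sign0.
Qed.

Theorem corollary5p2 (R : realType) (X Y : haar_system_norm R) (r1 r2 : bool)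
  (P : probability (signs * signs)%type R) (hP : haar_sign_measure r1 r2 P)
  (Z : completeNormedModType R) (e : {linear V2 R -> Z})
  (hZ : is_completion (Znorm P X Y) e)
  (U : set_system nat) (hU : UltraFilter U) (hUn : nonprincipal U) :
  let N := Znorm P X Y in
  (forall (D : {linear V2 R -> V2 R}) (d : dyadic -> dyadic -> R),
     haar_multiplier hk D d ->
     (T2S d < +oo)%E ->
     (T2S d < (`|lambda_fun U d - mu_fun U d| / 8)%:E)%E ->
     (opnorm N N capon <=
        (opnorm N N D + sup_norm d + 8%:E * T2S d) /
        (`|lambda_fun U d - mu_fun U d|%:E - 8%:E * T2S d))%E
     /\ ((opnorm N N D < +oo)%E ->
         exists C : {linear Z -> Z},
           (forall f, C (e f) = e (capon f)) /\
           (opnorm Num.norm Num.norm C < +oo)%E))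
  /\
  ((exists C : {linear Z -> Z},
      (forall f, C (e f) = e (capon f)) /\
      (opnorm Num.norm Num.norm C < +oo)%E) <->
   (exists (D : {linear Z -> Z}) (d : dyadic -> dyadic -> R),
      [/\ haar_multiplier (e \o hk) D d,
          (opnorm Num.norm Num.norm D < +oo)%E &
          lambda_fun U d <> mu_fun U d])).
Proof.
move=> N.
have [he e_dense] := hZ.
have NZ c f : N (c *: f) = `|c| * N f by rewrite /N -!he linearZ normrZ.
have N0 f : 0 <= N f by rewrite /N -he.
have root : dyadic := cell (fun=> false) 0.
(* Shared by both halves: B is the sup norm of d in the first and the operator norm in the
   second. *)
have bound (d : dyadic -> dyadic -> R) K B :
    (forall M a, supp_below M a -> N (hsum (mult d a)) <= K * N (hsum a)) ->
    (forall I J, `|d I J| <= B) -> 0 < `|lambda_fun U d - mu_fun U d| ->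
    0 <= (K + B) / `|lambda_fun U d - mu_fun U d| /\
    forall f, N (capon f) <= (K + B) / `|lambda_fun U d - mu_fun U d| * N f.
  move=> hK dB gap; split=> [|f].
    rewrite divr_ge0 // addr_ge0 //.
      exact: le_trans (normr_ge0 _) (multiplier_coef_le he hK root root).
    exact: le_trans (normr_ge0 _) (dB root root).
  by rewrite mulrAC ler_pdivlMr // mulrC; exact: (capon_bound hU hUn hP he hK dB).
have extend C0 : 0 <= C0 -> (forall f, N (capon f) <= C0 * N f) ->
    exists C : {linear Z -> Z}, (forall f, C (e f) = e (capon f)) /\
      (opnorm Num.norm Num.norm C < +oo)%E.
  move=> C00 hC; have [|C [Ce Cb]] := dense_extension e_dense (capon_linear e) C00.
    by move=> f; rewrite !he.
  by exists C; split=> //; apply: le_lt_trans (opnorm_le C00 Cb) (ltry _).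
split.
  move=> D d hD T2Sfin T2Slt.
  set gap := `|lambda_fun U d - mu_fun U d| in T2Slt *.
  have Dmult : forall M a, supp_below M a -> D (hsum a) = hsum (mult d a).
    exact: (@mult_linear _ _ (idfun : {linear V2 R -> V2 R}) D d hD).
  have D0 : (0 <= opnorm N N D)%E by apply: opnorm_ge0 => // c f; rewrite linearZ.
  have [t tE] : exists t, T2S d = t%:E.
    by exists (fine (T2S d)); rewrite fineK // ge0_fin_numE // T2S_ge0.
  have t0 : 0 <= t by have := T2S_ge0 d; rewrite tE.
  move: T2Slt; rewrite tE lte_fin ltr_pdivlMr // => tgap.
  have gap0 : 0 < gap by apply: le_lt_trans tgap; rewrite mulr_ge0.
  have S0 : (0 <= sup_norm d)%E.
    apply: (@le_trans _ _ `|d root root|%:E); first by rewrite lee_fin.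
    by apply: ereal_sup_ubound; exists (root, root).
  have finite_case : (opnorm N N D < +oo)%E -> exists K B, [/\ opnorm N N D = K%:E,
      sup_norm d = B%:E, 0 <= (K + B) / gap &
      forall f, N (capon f) <= (K + B) / gap * N f].
    move=> Dfin; pose K := fine (opnorm N N D).
    have KE : opnorm N N D = K%:E by rewrite fineK // ge0_fin_numE.
    have hK M a : supp_below M a -> N (hsum (mult d a)) <= K * N (hsum a).
      move=> aM; rewrite -(Dmult _ _ aM).
      apply: (opnorm_bound NZ NZ) => //; last by rewrite KE.
      by move=> c f; rewrite linearZ.
    have Sfin : (sup_norm d < +oo)%E.
      apply: (@le_lt_trans _ _ K%:E); last exact: ltry.
      apply: ge_ereal_sup => _ [p _ <-]; rewrite lee_fin.
      exact: (multiplier_coef_le he hK).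
    pose B := fine (sup_norm d).
    have BE : sup_norm d = B%:E by rewrite fineK // ge0_fin_numE.
    have dB I J : `|d I J| <= B.
      by rewrite -lee_fin -BE; apply: ereal_sup_ubound; exists (I, J).
    by exists K, B; have [] := bound d K B hK dB gap0.
  split; last by move=> /finite_case[K [B [_ _ C0 hC]]]; exact: extend hC.
  have den0 : 0 < gap - 8 * t by rewrite subr_gt0 mulrC.
  rewrite -EFinM -EFinB inver gt_eqF //.
  (* An infinite operator norm makes the right-hand side +oo: the other summands are not -oo and the
     denominator is positive. *)
  have [Dfin|] := ltP (opnorm N N D) +oo%E; last first.
    rewrite leye_eq => /eqP ->.
    rewrite addye ?addye // ?gt0_mulye ?leey // ?lte_fin ?invr_gt0 //.
    by rewrite -ltNye (lt_le_trans _ S0) // ltNy0.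
  have [K [B [-> BE C0 hC]]] := finite_case Dfin; rewrite BE.
  apply: le_trans (opnorm_le C0 hC) _.
  rewrite -!EFinD -EFinM lee_fin ler_pdivlMr // mulrAC ler_pdivrMr //.
  have KB : 0 <= K + B by move: C0; rewrite pmulr_lge0 ?invr_gt0.
  (* Adding 8 t to the numerator and removing it from the positive denominator only enlarges the
     nonnegative quotient (K + B) / gap. *)
  nra.
split=> [[C [Ce Cfin]]|[D [d [hD Dfin gap]]]].
  (* The extended Capon projection is itself the witness, with lambda = 1 and mu = 0. *)
  exists C, (capon_coef R); split=> //.
    move=> I J /=; rewrite Ce -linearZ /=; congr (e _).
    exact: capon_hk.
  by rewrite (lambda_capon R hU hUn) (mu_capon R hU hUn); apply/eqP; exact: oner_neq0.
have D0 : (0 <= opnorm (@Num.norm _ Z) (@Num.norm _ Z) D)%E.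
  by apply: opnorm_ge0 => [c f|c f|c f]; rewrite ?normrZ ?linearZ.
pose K := fine (opnorm (@Num.norm _ Z) (@Num.norm _ Z) D).
have KE : opnorm (@Num.norm _ Z) (@Num.norm _ Z) D = K%:E by rewrite fineK // ge0_fin_numE.
have hK M a : supp_below M a -> N (hsum (mult d a)) <= K * N (hsum a).
  move=> aM; rewrite /N -!he -(mult_linear hD aM).
  by apply: opnorm_bound => [c f|c f|c f|f|]; rewrite ?normrZ ?linearZ ?KE.
(* The operator norm also bounds the coefficients, so it serves as B. *)
have [|C0 hC] := bound d K K hK (multiplier_coef_le he hK); last exact: extend hC.
by rewrite normr_gt0 subr_eq0; apply/eqP.
Qed.
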